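(* Let $\{C_r: r\in\mathbb{Q}\cap[0,1]\}$ be a collection of Cantor sets in $(0,1]$ such that, for $r>s$, $C_r\subsetneq C_s$ and no point of $C_r$ is an endpoint of $C_s$. Let $f:[0,1]\to[0,1]$ be a continuous function such that $f(t)=0$ for all $t\in\{0\}\cup C_0$, $f(t)<\min C_0$ for all $t\in[0,1]$, and $f(t)<t$ for all $t\in(0,1]$. Define $F:[0,1]\to 2^{[0,1]}$ by $F(t)=\{f(t)\}$ if $t\notin C_0$ and $F(t)=[0,\sup\{r\in\mathbb{Q}\cap[0,1]: t\in C_r\}]$ if $t\in C_0$. Then $X=\varprojlim\{[0,1],F\}$ is a hereditarily decomposable tree-like continuum.
   Context: A continuum is a nonempty, compact, connected metric space. $2^{[0,1]}$ is the collection of nonempty compact subsets of $[0,1]$. A set $C\subseteq[0,1]$ is a Cantor set if it is nonempty, closed, perfect and nowhere dense. A point $x\in C$ is a left endpoint of $C$ if there is $a<x$ with $(a,x)\subseteq[0,1]\setminus C$, and a right endpoint of $C$ if there is $a>x$ with $(x,a)\subseteq[0,1]\setminus C$; an endpoint is a left or right endpoint. With $\omega=\{0,1,2,\dots\}$, the inverse limit is $\varprojlim\{[0,1],F\}=\{(x_0,x_1,\dots)\in[0,1]^{\omega}: x_{i-1}\in F(x_i)\text{ for all } i\ge 1\}$, with the subspace topology from the product. A nondegenerate continuum is decomposable if it is the union of two proper subcontinua; a continuum is hereditarily decomposable if each of its nondegenerate subcontinua is decomposable. A tree is a uniquely arcwise connected union of finitely many arcs. A continuum is tree-like if it is homeomorphic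 to an inverse limit (with continuous single-valued bonding maps) on trees. *)

(* Defs.v *)
From HB Require Import structures.
From mathcomp Require Import all_boot all_order all_algebra.
From mathcomp Require Import all_classical all_reals all_analysis.

Set Implicit Arguments.
Unset Strict Implicit.
Unset Printing Implicit Defensive.

Import Order.TTheory GRing.Theory Num.Theory.
Import numFieldNormedType.Exports.

Local Open Scope classical_set_scope.
Local Open Scope ring_scope.

(* Spaces are represented as subsets of an ambient topological space, with the
   subspace topology; the functions between them are total functions on the
   ambient types, constrained only on the subsets. *)

Section Spaces.
Variable R : realType.

(* [d] is a metric on [A] that induces the subspace topology of [A]. *)
Definition metric_for (T : topologicalType) (A : set T) (d : T -> T -> R) :=
  [/\ forall x y, A x -> A y -> (d x y = 0 <-> x = y),
      forall x y, A x -> A y -> d x y = d y x,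
      forall x y z, A x -> A y -> A z -> d x z <= d x y + d y z &
      forall x, A x -> forall U : set T,
        within A (nbhs x) U <->
        exists2 e : R, 0 < e & forall y, A y -> d x y < e -> U y].

Definition metrizable (T : topologicalType) (A : set T) :=
  exists d : T -> T -> R, metric_for A d.

Definition continuum (T : topologicalType) (A : set T) :=
  [/\ A !=set0, compact A, connected A & metrizable A].

Definition nondegenerate (T : Type) (A : set T) :=
  exists x y, [/\ A x, A y & x <> y].

Definition decomposable (T : topologicalType) (A : set T) :=
  exists K L : set T,
    [/\ continuum K, continuum L, K `<` A, L `<` A & A = K `|` L].

Definition hereditarily_decomposable (T : topologicalType) (A : set T) :=
  forall B : set T, B `<=` A -> continuum B -> nondegenerate B ->
    decomposable B.

Definition homeomorphism (T U : topologicalType) (A : set T) (B : set U)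
    (f : T -> U) (g : U -> T) :=
  [/\ set_fun A B f, set_fun B A g,
      (forall x, A x -> g (f x) = x) /\ (forall y, B y -> f (g y) = y),
      {within A, continuous f} & {within B, continuous g}].

Definition homeomorphic (T U : topologicalType) (A : set T) (B : set U) :=
  exists (f : T -> U) (g : U -> T), homeomorphism A B f g.

Definition arc (T : topologicalType) (K : set T) :=
  homeomorphic (`[0, 1]%classic : set R) K.

Definition arc_between (T : topologicalType) (x y : T) (K : set T) :=
  exists (h : R -> T) (k : T -> R),
    [/\ homeomorphism (`[0, 1]%classic : set R) K h k, h 0 = x & h 1 = y].

Definition uniquely_arcwise_connected (T : topologicalType) (A : set T) :=
  forall x y, A x -> A y -> x <> y ->
    exists! K : set T, K `<=` A /\ arc_between x y K.

(* The clause [continuum A] excludes the empty union and, as the ambient space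
   need not be Hausdorff, non-metrizable unions of arcs. *)
Definition tree (T : topologicalType) (A : set T) :=
  [/\ continuum A, uniquely_arcwise_connected A &
      exists (n : nat) (K : nat -> set T),
        (forall i, (i < n)%N -> arc (K i)) /\ A = \bigcup_(i < n) K i].

(* Inverse limit of the set-valued functions F i : A i.+1 -> 2^(A i); a
   single-valued bonding map g is the case F i t = [set g i t]. *)
Definition inverse_limit (T : nat -> Type) (A : forall i, set (T i))
    (F : forall i, T i.+1 -> set (T i)) : set (prod_topology T) :=
  [set x | (forall i, A i (x i)) /\ (forall i, F i (x i.+1) (x i))].

Definition tree_like (T : topologicalType) (A : set T) :=
  exists (U : nat -> topologicalType) (D : forall i, set (U i))
         (g : forall i, U i.+1 -> U i),
    [/\ forall i, tree (D i),
        forall i, set_fun (D i.+1) (D i) (g i),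
        forall i, {within D i.+1, continuous (g i)} &
        homeomorphic A (inverse_limit D (fun i t => [set g i t]))].

(* For subsets of [0, 1], closedness and nowhere density in [0, 1] agree with
   closedness and nowhere density in R. [perfect_set] contains [closed]. *)
Definition cantor_set (C : set R) :=
  [/\ C `<=` `[0, 1]%classic, C !=set0, perfect_set C & interior (closure C) = set0].

Definition left_endpoint (C : set R) (x : R) :=
  C x /\ exists2 a, a < x & `]a, x[ `<=` (`[0, 1]%classic `\` C).

Definition right_endpoint (C : set R) (x : R) :=
  C x /\ exists2 a, x < a & `]x, a[ `<=` (`[0, 1]%classic `\` C).

Definition endpoint (C : set R) (x : R) :=
  left_endpoint C x \/ right_endpoint C x.

Definition is_min (A : set R) (m : R) := A m /\ lbound A m.

Definition bonding (C : rat -> set R) (f : R -> R) (t : R) : set R :=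
  if t \in C 0 then
    `[0, sup [set (ratr r : R) | r in [set r : rat | 0 <= r <= 1 /\ C r t]]]%classic
  else [set f t].

End Spaces.

(* Main.v *)
Require Import Defs.
From HB Require Import structures.
From mathcomp Require Import all_boot all_order all_algebra.
From mathcomp Require Import all_classical all_reals all_analysis.
From mathcomp Require Import zify lra.

Set Implicit Arguments.
Unset Strict Implicit.
Unset Printing Implicit Defensive.

Import Order.TTheory GRing.Theory Num.Theory.
Import numFieldNormedType.Exports.
Local Open Scope classical_set_scope.
Local Open Scope ring_scope.

(** Write [phi t] for the supremum of the [r] with [t] in [C r], and [0] when
there is none.  Off [C 0] the bonding function is [f], and it takes the values
[0, phi t] on [C 0], where [f] vanishes; so [x] lies in the limit exactly when
the differences [z i = x i - f (x i.+1)] satisfy [0 <= z i <= phi (x i.+1)].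
Since [f] stays below [C 0], a nonzero coordinate of [z] forces all later
coordinates of [x] into [C 0], where [f] is zero.  Hence [x |-> z] is a
homeomorphism of the limit onto the same limit with [f] replaced by [0], namely
the space of all [z] with [0 <= z i <= phi (z i.+1)]: the function [f]
disappears ([flattening_image], [flattening_inj]).

The flat limit is a comb.  If [z i > 0] then all later coordinates lie in [C 0],
and replacing [z 0, ..., z i] by [0, ..., 0, s] with [s <= z i] stays in the
space; lowering the coordinates of [z] to [0] one after the other therefore
traces an arc from [z] to the root [0].  Since [C 0] contains no interval, a
point [0, ..., 0, s, z i.+1, ...] with [s] outside [C 0] separates what is above
it from the rest: a closed connected set that contains [z] and some point not
above the given one contains the given one ([comb_cut]).  The three conclusions
follow.

- Continuum: the space is compact, the condition on [phi] being closed, and it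
  is star-shaped about [0], hence connected ([star_connected]).

- Hereditary decomposability ([comb_hereditarily_decomposable]): a subcontinuum
  either can be cut at a single point into two closed pieces, or contains [0]
  and two branches that are told apart by a later coordinate, a coordinate which
  varies in a zero-dimensional set.  In that case the points on each side,
  together with those where the earlier coordinate vanishes, form two closed
  pieces whose intersection is star-shaped about [0].  Closed pieces with
  connected union and connected intersection are connected ([connected_split]).

- Tree-likeness ([limit_space_tree_like]): apply to the first [n.+1] coordinates
  a nondecreasing function that grows only across finitely many gaps of [C 0], and
  forget the other coordinates.  The image is again a comb, now over a finite
  set, hence a finite union of arcs; [comb_cut] makes its arcs unique, so that it
  is a tree ([comb_tree]).  Letting the number of gaps and of coordinates grow,
  these images separate points, and compactness identifies the space with their
  inverse limit ([tree_like_collapse]). *)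

(** * Sequences of reals with the product topology *)
Section Product.

Lemma cvg_prod_topology (I : Type) (K : I -> topologicalType)
    (F : set_system (prod_topology K)) (x : prod_topology K) : Filter F ->
  (forall i, (fun y : prod_topology K => y i) @ F --> x i) -> F --> x.
Proof.
move=> FF Fx; apply/cvg_sup => i U [V] [[W] oW <-] Wx WU.
apply: (filterS WU); apply: (Fx i).
by apply: open_nbhs_nbhs.
Qed.

Lemma prod_coord_continuous (K : nat -> topologicalType) i :
  continuous (fun x : prod_topology K => x i).
Proof. exact: (@proj_continuous nat K i). Qed.

Lemma within_continuous_prod (S : topologicalType) (I : Type)
    (K : I -> topologicalType) (A : set S) (h : S -> prod_topology K) :
  (forall i, {within A, continuous (fun s => h s i)}) ->
  {within A, continuous h}.
Proof.
move=> hc; apply/subspace_continuousP => x Ax.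
apply: cvg_prod_topology => i.
exact: (@subspace_continuousP _ A _ (fun s => h s i)).1 (hc i) x Ax.
Qed.

End Product.

Notation seqR R := (prod_topology (fun _ : nat => (R : Type))).

Section Sequences.
Variable R : realType.
Implicit Types x y : seqR R.

Lemma seqR_hausdorff : hausdorff_space (seqR R).
Proof.
by apply: (@hausdorff_product nat (fun _ => R)) => i; exact: norm_hausdorff.
Qed.

Lemma nbhs_box x (U : set (seqR R)) : nbhs x U ->
  exists J e, 0 < e /\ forall y, (forall j, (j < J)%N -> `|y j - x j| < e) -> U y.
Proof.
pose G : set_system (seqR R) := [set U | exists J e, 0 < e /\
  forall y, (forall j, (j < J)%N -> `|y j - x j| < e) -> U y].
have FG : Filter G.
  split; first by exists 0%N, 1; split.
    move=> A B [J1 [e1 [e10 H1]]] [J2 [e2 [e20 H2]]].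
    exists (maxn J1 J2), (Num.min e1 e2); split; first by rewrite lt_min e10.
    move=> y Hy; split; [apply: H1|apply: H2] => j jJ;
      have := Hy j; rewrite leq_max jJ ?orbT lt_min => /(_ isT) /andP[]//.
  by move=> A B AB [J [e [e0 H]]]; exists J, e; split=> // y /H /AB.
suff : G --> x by exact.
apply: cvg_prod_topology => i V; rewrite nbhs_ballP => -[e /= e0 eV].
exists i.+1, e; split => // y /(_ i (ltnSn i)) yi; apply: eV.
by rewrite /ball /= distrC.
Qed.

Lemma box_nbhs x J e : 0 < e ->
  nbhs x [set y : seqR R | forall j, (j < J)%N -> `|y j - x j| < e].
Proof.
move=> e0; elim: J => [|J IH]; first by apply: filterE => y.
have NJ : nbhs x [set y : seqR R | `|y J - x J| < e].
  have bx : nbhs (x J) [set t : R | `|t - x J| < e].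
    by apply/nbhs_ballP; exists e => // t; rewrite /ball /= distrC.
  exact: (@prod_coord_continuous (fun _ => R) J x _ bx).
apply: filterS (filterI IH NJ) => y [H1 H2] j.
by rewrite ltnS leq_eqVlt => /orP[/eqP->//|/H1].
Qed.

Lemma closed_seqP (B : set (seqR R)) x : closed B ->
  (forall J e, 0 < e ->
     exists2 y, B y & forall j, (j < J)%N -> `|y j - x j| < e) -> B x.
Proof.
move=> cB H; apply: cB => U /nbhs_box[J [e [e0 HU]]].
by have [y By yx] := H J e e0; exists y; split => //; exact: HU.
Qed.

Lemma open_coord_lt i (a : R) : open [set x : seqR R | x i < a].
Proof.
by apply: (open_comp (f := fun x : seqR R => x i) (D := [set t | t < a]));
  [move=> *; exact: (@prod_coord_continuous (fun _ => R))|exact: open_lt].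
Qed.

Lemma open_coord_gt i (a : R) : open [set x : seqR R | a < x i].
Proof.
by apply: (open_comp (f := fun x : seqR R => x i) (D := [set t | a < t]));
  [move=> *; exact: (@prod_coord_continuous (fun _ => R))|exact: open_gt].
Qed.

Lemma open_box_tail i J (a b : nat -> R) :
  open [set x : seqR R | forall j, (i < j < J)%N -> a j < x j < b j].
Proof.
elim: J => [|J IH].
  rewrite (_ : [set _ | _] = setT); first exact: openT.
  by apply/seteqP; split=> // x _ j; rewrite ltn0 andbF.
case: (ltnP i J) => iJ; last first.
  rewrite (_ : [set _ | _] = setT); first exact: openT.
  apply/seteqP; split=> // x _ j; rewrite ltnS => /andP[ij jJ].
  by move: (leq_trans ij (leq_trans jJ iJ)); rewrite ltnn.
rewrite (_ : [set _ | _] = [set x : seqR R | forall j, (i < j < J)%N -> a j < x j < b j]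
    `&` ([set x : seqR R | a J < x J] `&` [set x : seqR R | x J < b J])).
  by apply: openI => //; apply: openI; [exact: open_coord_gt|exact: open_coord_lt].
apply/seteqP; split=> x /=.
  move=> H; split=> [j /andP[ij jJ]|]; first by apply: H; rewrite ij ltnW.
  by apply/andP/H; rewrite iJ /=.
move=> [H1 [H2 H3]] j /andP[ij]; rewrite ltnS leq_eqVlt => /orP[/eqP->|jJ].
  by rewrite H2.
by apply: H1; rewrite ij.
Qed.

Lemma closed_coord i (A : set R) : closed A -> closed [set x : seqR R | A (x i)].
Proof.
move=> cA; apply: (closed_comp (f := fun x : seqR R => x i)) => // x _.
exact: (@prod_coord_continuous (fun _ => R)).
Qed.

(** Capping the difference of the [k]-th coordinates at [1 / k.+1] makes the
supremum finite and leaves finitely many coordinates to control at any given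
precision, which is how the product topology behaves. *)
Lemma metrizable_seqR (A : set (seqR R)) : metrizable R A.
Proof.
pose w k : R := k.+1%:R^-1.
have w0 k : 0 < w k by rewrite invr_gt0.
have w1 k : w k <= 1 by rewrite invf_le1 // ler1n.
pose m x y k : R := Num.min `|x k - y k| (w k).
have m0 x y k : 0 <= m x y k by rewrite le_min normr_ge0 ltW.
pose d x y := sup (range (m x y)).
have hs x y : has_sup (range (m x y)).
  split; first by exists (m x y 0%N), 0%N.
  by exists 1 => _ [k _ <-]; rewrite ge_min w1 orbT.
have dge x y k : m x y k <= d x y by apply: ub_le_sup; [exact: (hs x y).2|exists k].
have dle x y e : (forall k, m x y k <= e) -> d x y <= e.
  by move=> H; apply: ge_sup; [exact: (hs x y).1|move=> _ [k _ <-]].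
exists d; split.
- move=> x y _ _; split=> [dxy|<-].
    apply: functional_extensionality_dep => k; have := dge x y k.
    by rewrite dxy ge_min [w k <= 0]leNgt w0 orbF normr_le0 subr_eq0 => /eqP.
  apply/eqP; rewrite eq_le (le_trans _ (dge x x 0%N)) // andbT.
  by apply: dle => k; rewrite /m subrr normr0 ge_min lexx.
- by move=> x y _ _; congr sup; apply: eq_imagel => k _; rewrite /m distrC.
- move=> x y z _ _ _; apply: dle => k.
  have := lerD (dge x y k) (dge y z k); apply: le_trans.
  have := ler_distD (y k) (x k) (z k); have := w0 k.
  have := normr_ge0 (x k - y k); have := normr_ge0 (y k - z k).
  by rewrite /m; case: (leP `|x k - z k| (w k)); case: (leP `|x k - y k| (w k));
    case: (leP `|y k - z k| (w k)); lra.
move=> x Ax U; split=> [nU|[e e0 H]].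
  have [J [e [e0 H]]] := nbhs_box nU.
  exists (Num.min e (w J)); first by rewrite lt_min e0 w0.
  move=> y Ay dxy; apply: H => // j jJ.
  have := le_lt_trans (dge x y j) dxy.
  have wJj : w J < w j by rewrite ltf_pV2 ?posrE // ltr_nat ltnS.
  rewrite /m distrC; case: (leP e (w J)); case: (leP `|y j - x j| (w j)); lra.
have [J wJ] : exists J, w J < e / 2.
  exists (Num.truncn (e / 2)^-1); rewrite invf_plt ?posrE ?divr_gt0 //.
  exact: truncnS_gt.
apply: filterS (box_nbhs x J (divr_gt0 e0 (ltr0Sn _ 1))) => y Hy Ay.
apply: H => //; apply: (@le_lt_trans _ _ (e / 2)); last by lra.
apply: dle => k; rewrite ge_min; case: (ltnP k J) => kJ.
  by rewrite distrC ltW // Hy.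
suff -> : w k <= e / 2 by rewrite orbT.
by apply: le_trans (ltW wJ); rewrite lef_pV2 ?posrE // ler_nat ltnS.
Qed.

End Sequences.

(** * Compactness, connectedness and inverse limits *)
Section Compact.

Lemma within_comp_nbhs (S T : topologicalType) (A : set S) (p : S -> T) a V :
  {within A, continuous p} -> A a -> nbhs (p a) V ->
  nbhs a [set s | A s -> V (p s)].
Proof. move=> pc Aa nV.
have := (@subspace_continuousP _ A _ p).1 pc a Aa V nV.
by rewrite /= nbhs_simpl. Qed.

Lemma within_continuous_eq (S T : topologicalType) (A : set S) (f g : S -> T) :
  {within A, continuous f} -> (forall x, A x -> f x = g x) ->
  {within A, continuous g}.
Proof.
by move=> fc fg; apply: (subspace_eq_continuous _ fc) => x /set_mem Ax; exact: fg.
Qed.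

(** A continuous map on a compact set is a quotient map onto its Hausdorff
image: it sends compact, hence closed, sets to closed sets. *)
Lemma continuous_factor (S T U : topologicalType) (A : set S) (p : S -> T)
    (g : T -> U) : compact A -> hausdorff_space T ->
  {within A, continuous p} -> {within A, continuous (g \o p)} ->
  {within p @` A, continuous g}.
Proof.
move=> cA hT pc gpc; apply/subspace_continuousP => _ [a Aa <-] V.
rewrite nbhsE => -[W [oW Wgpa] WV].
have [F cF FA] : exists2 F, closed (F : set S) & F `&` A = (g \o p) @^-1` (~` W) `&` A.
  by apply/closed_subspaceP; apply: (continuous_closedP _).1 => //; exact: open_closedC.
have cE : compact (A `&` F) by exact: compact_closedI.
have cpE : closed (p @` (A `&` F)).
  apply: compact_closed => //; apply: continuous_compact => //.
  by apply: continuous_subspaceW pc; exact: subIsetl.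
suff : nbhs (p a) (~` (p @` (A `&` F))).
  apply: filterS => t /= nE [b Ab pbt]; subst t; apply: WV.
  apply: contrapT => nW; apply: nE; exists b => //; split=> //.
  by have [] : (F `&` A) b by rewrite FA; split.
apply: open_nbhs_nbhs; split; first exact: closed_openC.
move=> [b [Ab Fb] pba]; have : (F `&` A) b by [].
by rewrite FA => -[/=]; rewrite pba.
Qed.

Lemma injective_homeomorphism (S T : topologicalType) (A : set S) (h : S -> T) :
  A !=set0 -> compact A -> hausdorff_space T -> {within A, continuous h} ->
  set_inj A h -> exists k, homeomorphism A (h @` A) h k.
Proof.
move=> [a0 Aa0] cA hT hc hi.
pose k t := xget a0 (A `&` [set s | h s = t]).
have kP s : A s -> k (h s) = s.
  move=> As; have [Ak hk] : (A `&` [set r | h r = h s]) (k (h s)).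
    by apply: xgetPex; exists s.
  by apply: hi => //; rewrite inE.
exists k; split => //.
- by move=> _ [s As <-]; rewrite kP.
- by split=> [s|_ [s As <-]]; [exact: kP|rewrite kP].
apply: continuous_factor => //.
have idc : {within A, continuous (id : S -> S)}.
  by apply: continuous_subspaceT => s; exact: cvg_id.
by apply: (within_continuous_eq idc) => s As /=; rewrite kP.
Qed.

End Compact.

Section Connected.
Variable T : topologicalType.
Implicit Types A B K L : set T.

Lemma connected_clopen B (U F : set T) : connected B -> open U -> closed F ->
  (forall x, B x -> (U x <-> F x)) -> (B `&` U) !=set0 -> B `<=` U.
Proof.
move=> cB oO cF OF ne; have : B `&` U = B.
  apply: cB => //; first by exists U.
  exists F => //; apply/seteqP; split=> x [Bx] /(OF x Bx); by [].
by move=> <- x [].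
Qed.

(** A relatively clopen part of [K] that avoids [L] is clopen in the union, and
a connected intersection lies entirely on one side of any clopen splitting of
[K]. *)
Lemma connected_split K L : closed K -> closed L -> connected (K `|` L) ->
  connected (K `&` L) -> connected K.
Proof.
move=> cK cL cKL cI E E0 [U oO EO] [F cF EF].
have key (U' F' : set T) : open U' -> closed F' -> K `&` U' = K `&` F' ->
    K `&` U' !=set0 -> (forall x, K x -> L x -> ~ U' x) -> K `|` L `<=` U'.
  move=> oO' cF' OF' [x [Kx U'x]] nL.
  have H : K `|` L `<=` U' `&` ~` L.
    apply: (@connected_clopen _ _ (K `&` F')) => //.
    - by apply: openI => //; exact: closed_openC.
    - exact: closedI.
    - move=> y KLy; rewrite -OF'; split=> [[U'y nLy]|[Ky U'y]].
        by split=> //; case: KLy.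
      by split=> // Ly; exact: nL U'y.
    - by exists x; split; [left|split=> // Lx; exact: nL U'x].
  by move=> y /H[].
have UFK x : K x -> (U x <-> F x).
  move=> Kx; have : (K `&` U) x <-> (K `&` F) x by rewrite -EO -EF.
  by move=> [h1 h2]; split=> h; [case: h1|case: h2].
have [[x [[Kx Lx] Ox]]|nI] := pselect (K `&` L `&` U !=set0).
  have LU : K `&` L `<=` U.
    by apply: (@connected_clopen _ _ F) => // [y [Ky _]|]; [exact: UFK|exists x].
  have [[y [Ky nOy]]|nE] := pselect (K `&` ~` U !=set0).
    have nUF z : K z -> ((~` U) z <-> (~` F) z).
      by move=> Kz; rewrite /= (propext (UFK z Kz)).
    have H : K `|` L `<=` ~` F.
      apply: (key _ (~` U)); [exact: closed_openC|exact: open_closedC| | |].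
      - by apply/seteqP; split=> z [Kz h]; split=> //; apply/(nUF z Kz).
      - by exists y; split=> //; apply/(nUF y Ky).
      - by move=> z Kz Lz; apply; apply/(UFK z Kz); exact: LU.
    by move: E0 => [z]; rewrite EF => -[Kz Fz]; case: (H z (or_introl Kz)).
  rewrite EO; apply/seteqP; split=> [y []//|y Ky]; split=> //.
  by apply: contrapT => nO; apply: nE; exists y.
have H : K `|` L `<=` U.
  apply: (key U F) => //; rewrite -?EO // => z Kz Lz Oz.
  by apply: nI; exists z.
rewrite EO; apply/seteqP; split=> [y []//|y Ky]; split=> //.
by apply: H; left.
Qed.

End Connected.

Section InverseLimit.
Variables (R : realType) (S T : topologicalType).

(** Maps [p i] of a compact space onto trees, each factoring through the next and
jointly injective, present the space as an inverse limit of trees.  The bonding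
maps are the factors; a thread is attained at any cluster point of a sequence
whose [i]-th term lies over the [i]-th coordinate of the thread. *)
Lemma tree_like_collapse (A : set S) (p : nat -> S -> T) :
  A !=set0 -> compact A -> hausdorff_space T ->
  (forall i, {within A, continuous (p i)}) ->
  (forall i x y, A x -> A y -> p i.+1 x = p i.+1 y -> p i x = p i y) ->
  (forall x y, A x -> A y -> (forall i, p i x = p i y) -> x = y) ->
  (forall i, tree R (p i @` A)) ->
  tree_like R A.
Proof.
move=> A0 cA hT pc pS pinj ptree; have [a0 Aa0] := A0.
pose g i t := p i (xget a0 (A `&` [set s | p i.+1 s = t])).
have gP i s : A s -> g i (p i.+1 s) = p i s.
  move=> As; have [Ak hk] : (A `&` [set r | p i.+1 r = p i.+1 s])
      (xget a0 (A `&` [set r | p i.+1 r = p i.+1 s])) by apply: xgetPex; exists s.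
  exact: pS.
exists (fun _ => T), (fun i => p i @` A), g; split => //.
- by move=> i _ [s As <-]; rewrite gP //; exists s.
- move=> i; apply: continuous_factor => //.
  by apply: (within_continuous_eq (pc i)) => s As /=; rewrite gP.
pose h (s : S) : prod_topology (fun _ : nat => T) := fun i => p i s.
have hT' : hausdorff_space (prod_topology (fun _ : nat => T)).
  exact: (@hausdorff_product nat (fun _ => T)).
have hc : {within A, continuous h} by exact: within_continuous_prod.
have hi : set_inj A h.
  move=> x y /set_mem Ax /set_mem Ay hxy; apply: pinj => // i.
  by have := congr1 (fun z : prod_topology (fun _ : nat => T) => z i) hxy.
have [k hk] := injective_homeomorphism A0 cA hT' hc hi.
exists h, k; suff -> : inverse_limit (fun i => p i @` A) (fun i t => [set g i t]) = h @` A.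
  by [].
apply/seteqP; split=> [y [yA yg]|_ [s As <-]]; last first.
  by split=> i; [exists s|rewrite /= /h gP].
have /choice[x xP] : forall i, exists s, A s /\ p i s = y i.
  by move=> i; have [s As ps] := yA i; exists s.
have px i j : p i (x (i + j)%N) = y i.
  elim: j i => [|j IH] i; first by rewrite addn0 (xP i).2.
  by rewrite (yg i) -(IH i.+1) addSnnS gP //; exact: (xP _).1.
have [s [As cs]] : A `&` cluster (x @ \oo) !=set0.
  by apply: cA; exists 0%N => // i _; exact: (xP i).1.
exists s => //; apply: functional_extensionality_dep => i.
apply: hT => U V nU nV; have nU' := within_comp_nbhs (pc i) As nU.
have [|r [[Ar pr] rV]] := cs [set r | A r /\ p i r = y i] _ _ nU'.
  exists i => // j /= ij; split; first exact: (xP j).1.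
  by rewrite -(px i (j - i)%N) subnKC.
by exists (y i); split; [rewrite -pr; exact: rV|exact: nbhs_singleton].
Qed.

End InverseLimit.

(** * Combs *)
Section Combs.
Variable R : realType.
Implicit Types (B D H : set (seqR R)) (S : set R) (v w x y : seqR R).

(** As [i] grows, and [s] decreases from [v i] to [0] for each [i], these points
trace the path from [v] down to the zero sequence. *)
Definition trunc (i : nat) (s : R) (v : seqR R) : seqR R :=
  fun j => if (j < i)%N then 0 else if j == i then s else v j.

Lemma truncE i s v : trunc i s v i = s.
Proof. by rewrite /trunc ltnn eqxx. Qed.

Lemma trunc_lt i s v j : (j < i)%N -> trunc i s v j = 0.
Proof. by rewrite /trunc => ->. Qed.

Lemma trunc_gt i s v j : (i < j)%N -> trunc i s v j = v j.
Proof. by rewrite /trunc => ij; rewrite ltnNge ltnW //= gtn_eqF. Qed.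

(** Consecutive segments of that path share an endpoint. *)
Lemma trunc0 i v : trunc i.+1 (v i.+1) v = trunc i 0 v.
Proof.
apply: functional_extensionality_dep => j; rewrite /trunc ltnS leq_eqVlt.
by case: (ltngtP j i) => //= ij; case: eqP => // ->.
Qed.

Lemma trunc_id v : trunc 0 (v 0%N) v = v.
Proof.
by apply: functional_extensionality_dep => j; rewrite /trunc /=; case: eqP => [->|].
Qed.

Lemma trunc_continuous i v (A : set R) :
  {within A, continuous (fun s => trunc i s v)}.
Proof.
apply: within_continuous_prod => j; apply: continuous_subspaceT => s.
rewrite /trunc; case: (j < i)%N; first exact: cvg_cst.
by case: (j == i); [exact: cvg_id|exact: cvg_cst].
Qed.

(** Each point is joined to [0] by the closure of its path downwards, which adds
only [0], the limit of the truncations in the product topology. *)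
Lemma star_connected H : closed H -> (forall v i, H v -> 0 <= v i) ->
  H (fun _ => 0) ->
  (forall v i s, H v -> 0 <= s <= v i -> H (trunc i s v)) -> connected H.
Proof.
move=> cH H0 Hz Ht.
pose Q v k := [set trunc k s v | s in `[0, v k]%classic].
have Qc v k : connected (Q v k).
  apply: connected_continuous_connected; last exact: trunc_continuous.
  by apply/connected_intervalP; exact: interval_is_interval.
pose P v n := \bigcup_(k in [set k | (k <= n)%N]) Q v k.
have Pc v n : H v -> connected (P v n).
  move=> Hv; elim: n => [|n IH].
    rewrite (_ : P v 0%N = Q v 0%N) //; apply/seteqP; split=> [x [k]|x Qx].
      by rewrite /= leqn0 => /eqP->.
    by exists 0%N.
  rewrite (_ : P v n.+1 = P v n `|` Q v n.+1).
    apply: connectedU => //; exists (trunc n 0 v); split.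
      by exists n => //=; exists 0 => //=; rewrite in_itv /= lexx H0.
    by exists (v n.+1); rewrite ?trunc0 //= in_itv /= lexx H0.
  apply/seteqP; split=> [x [k /=]|x [[k /= kn Qx]|Qx]].
  - by rewrite leq_eqVlt => /orP[/eqP->|kn Qx]; [right|left; exists k].
  - by exists k => //=; rewrite leqW.
  - by exists n.+1 => /=.
pose A v := closure (\bigcup_n P v n).
have Ac v : H v -> connected (A v).
  move=> Hv; apply: connected_closure; apply: bigcup_connected => [|n _]; last exact: Pc.
  exists v => n _; exists 0%N => //; exists (v 0%N); last exact: trunc_id.
  by rewrite /= in_itv /= lexx H0.
have AH v : H v -> A v `<=` H.
  move=> Hv; rewrite [X in _ `<=` X](closure_id H).1 //; apply: closureS.
  by move=> x [n _ [k _ [s /=]]]; rewrite in_itv /= => sI xE; rewrite -xE; exact: Ht.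
have A0 v : H v -> A v (fun _ => 0).
  move=> Hv; apply: closed_seqP => [|J e e0]; first exact: closed_closure.
  exists (trunc J 0 v); last by move=> j jJ; rewrite trunc_lt // subrr normr0.
  apply: subset_closure; exists J => //; exists J => //=; exists 0 => //.
  by rewrite /= in_itv /= lexx H0.
have Av v : H v -> A v v.
  move=> Hv; apply: subset_closure; exists 0%N => //; exists 0%N => //; exists (v 0%N).
    by rewrite /= in_itv /= lexx H0.
  exact: trunc_id.
rewrite (_ : H = \bigcup_(v in H) A v).
  by apply: bigcup_connected => //; exists (fun _ => 0) => v Hv; exact: A0.
by apply/seteqP; split=> [v Hv|v [x Hx /(AH x Hx)]//]; exists v => //; exact: Av.
Qed.

(** The teeth attached along coordinate [i] sit over values of coordinate [i.+1]
that lie in [S].  As [S] contains no interval, bounds chosen outside [S] cut [D]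
into relatively clopen pieces wherever an earlier coordinate is positive. *)
Definition comb D S :=
  [/\ forall s, S s -> 0 < s,
      forall a b, a < b -> exists2 c, a < c < b & ~ S c,
      forall v i, D v -> 0 <= v i &
      forall v i, D v -> 0 < v i -> S (v i.+1)].

Section Fixed.
Variables (D : set (seqR R)) (S : set R).
Hypothesis DS : comb D S.

Lemma comb_up v i j : D v -> 0 < v i -> (i < j)%N -> S (v j).
Proof.
have [S0 _ _ DSv] := DS.
move=> Dv vi; elim: j => // j IH; rewrite ltnS leq_eqVlt => /orP[/eqP<-|/IH Svj].
  exact: DSv.
by apply: DSv => //; exact: S0.
Qed.

Lemma comb_below v i j : D v -> ~ S (v i) -> (j < i)%N -> v j = 0.
Proof.
have [_ _ D0 _] := DS.
move=> Dv nS ji; apply/eqP; rewrite eq_le D0 // andbT leNgt.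
by apply/negP => /(comb_up Dv)/(_ ji).
Qed.

(** Choose narrow bounds outside [S] around finitely many later coordinates of
[w].  If [B] had no point at level [s] in coordinate [i] within these bounds,
then its points above that level within the bounds would form a relatively
clopen subset containing [w] and missing [v].  A point at level [s] has zeros
before [i], because [s] is not in [S]; within the bounds it approximates the
truncation of [w], and [B] is closed. *)
Lemma comb_cut B w v i s : B `<=` D -> closed B -> connected B -> B w -> B v ->
  ~ S s -> 0 < s < w i ->
  ~ (s < v i /\ forall j, (i < j)%N -> v j = w j) -> B (trunc i s w).
Proof.
have [S0 Sd D0 _] := DS.
move=> BD cB kB Bw Bv nSs /andP[s0 swi] nv; apply: closed_seqP => // J0 e0 e00.
(* [e] and [J] tell [v] from [w] after [i] in case [v] is above level [s] *)
have [J [e [J0J e1 ee0 vfar]]] : exists J e, [/\ (J0 <= J)%N, 0 < e, e <= e0 &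
    s < v i -> exists2 j, (i < j < J)%N & e <= `|v j - w j| ].
  have [svi|nsvi] := pselect (s < v i); last by exists J0, e0; split.
  have [j [ij vj]] : exists j, (i < j)%N /\ v j <> w j.
    apply: contrapT => h; apply: nv; split=> // j ij.
    by apply: contrapT => vj; apply: h; exists j.
  exists (maxn J0 j.+1), (Num.min e0 `|v j - w j|); split.
  - exact: leq_maxl.
  - by rewrite lt_min e00 normr_gt0 subr_eq0; apply/eqP.
  - by rewrite ge_min lexx.
  - by exists j; rewrite ?ij ?leq_max ?ltnSn ?orbT // ge_min lexx orbT.
have /choice[a aP] : forall j, exists a, w j - e < a < w j /\ ~ S a.
  by move=> j; have [|a] := Sd (w j - e) (w j); [lra|exists a].
have /choice[b bP] : forall j, exists b, w j < b < w j + e /\ ~ S b.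
  by move=> j; have [|b] := Sd (w j) (w j + e); [lra|exists b].
pose P u := forall j, (i < j < J)%N -> a j < u j < b j.
have [[u [Bu usi Pu]]|no] := pselect (exists u : seqR R, [/\ B u, u i = s & P u]).
  exists u => // j jJ0; case: (ltngtP j i) => ij.
  - rewrite trunc_lt // (@comb_below u i) //; first by rewrite subrr normr0.
      exact: BD.
    by rewrite usi.
  - rewrite trunc_gt //; have /Pu : (i < j < J)%N by rewrite ij (leq_trans jJ0).
    by have [? _] := aP j; have [? _] := bP j; move=> ?; rewrite ltr_distlC; lra.
  - by rewrite ij truncE usi subrr normr0.
have : B `<=` [set u : seqR R | s < u i] `&` [set u : seqR R | P u].
  apply: (@connected_clopen _ _ _ ([set u : seqR R | s <= u i] `&`
     \bigcap_(j in [set j | (i < j < J)%N]) [set u : seqR R | a j <= u j <= b j])) => //.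
  - by apply: openI; [exact: open_coord_gt|exact: open_box_tail].
  - apply: closedI; first by apply: (closed_coord (A := [set t | s <= t])); exact: closed_ge.
    apply: closed_bigI => j _; apply: (closed_coord (A := `[a j, b j]%classic)).
    exact: interval_closed.
  - move=> u Bu; split=> [[/= su Pu]|[/= su Pu]].
      by split=> [|j /Pu /andP[? ?]] /=; [exact: ltW|rewrite !ltW].
    have Pu' : P u.
      move=> j ijJ; have /= /andP[au ub] := Pu j ijJ.
      have Suj : S (u j).
        apply: (@comb_up u i) => //; [exact: BD|lra|by case/andP: ijJ].
      rewrite !lt_neqAle au ub !andbT; apply/andP; split; apply/eqP => E.
        by apply: (aP j).2; rewrite E.
      by apply: (bP j).2; rewrite -E.
    split=> //=; rewrite lt_neqAle su andbT; apply/eqP => E.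
    by apply: no; exists u.
  - exists w; split=> //; split=> // j _.
    by have [? _] := aP j; have [? _] := bP j; lra.
move=> /(_ v Bv)[/= sv Pv]; have [j ijJ] := vfar sv; have := Pv j ijJ.
have [? _] := aP j; have [? _] := bP j; move=> ?.
by rewrite leNgt ltr_distlC; lra.
Qed.

Lemma trunc_closed B w i a b s : closed B -> a < b ->
  (forall t, a < t < b -> ~ S t -> B (trunc i t w)) -> a <= s <= b ->
  B (trunc i s w).
Proof.
have [_ Sd _ _] := DS.
move=> cB ab H /andP[as_ sb]; apply: closed_seqP => // J e e0.
have [|t /andP[t1 t2] nSt] := Sd (Num.max a (s - e)) (Num.min b (s + e)).
  by rewrite gt_max !lt_min; lra.
move: t1 t2; rewrite gt_max lt_min => /andP[at_ set_] /andP[tb tse].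
exists (trunc i t w); first by apply: H => //; rewrite at_.
move=> j _; rewrite /trunc; case: ifP => _; first by rewrite subrr normr0.
by case: eqP => _; rewrite ?subrr ?normr0 // ltr_distlC; lra.
Qed.

(** The restriction to levels outside [S] in [comb_cut] disappears by density. *)
Lemma comb_segment B w v i a s : B `<=` D -> closed B -> connected B ->
  B w -> B v -> 0 <= a < w i ->
  ~ (a < v i /\ forall j, (i < j)%N -> v j = w j) -> a <= s <= w i ->
  B (trunc i s w).
Proof.
move=> BD cB kB Bw Bv /andP[a0 awi] nv; apply: trunc_closed => // t tI nSt.
apply: (@comb_cut _ _ v) => //; first by lra.
by move=> [tv tl]; apply: nv; split => //; lra.
Qed.

End Fixed.
End Combs.

(** * Hereditary decomposability *)
Section Decomposition.
Variable R : realType.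
Implicit Types (B D K L X : set (seqR R)) (S : set R) (v w x y : seqR R).

Lemma continuum_seqR B : B !=set0 -> compact B -> connected B -> continuum R B.
Proof. by split=> //; exact: metrizable_seqR. Qed.

Lemma decomposable_split B K L x y : continuum R B -> closed K -> closed L ->
  B `<=` K `|` L -> connected (B `&` K `&` L) ->
  B x -> ~ K x -> B y -> ~ L y -> decomposable R B.
Proof.
move=> [B0 cB kB _] cK cL BKL kI Bx nKx By nLy.
have clB : closed B by apply: compact_closed => //; exact: seqR_hausdorff.
have BE : B = (B `&` K) `|` (B `&` L).
  by apply/seteqP; split=> [z Bz|z [[]|[]]//]; have [] := BKL z Bz; [left|right].
have IE : B `&` K `&` L = (B `&` K) `&` (B `&` L).
  by apply/seteqP; split=> [z [[]]|z [[? ?] []]]//.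
exists (B `&` K), (B `&` L); split=> //.
- apply: continuum_seqR; [|exact: compact_closedI|].
    by exists y; split=> //; case: (BKL y By).
  by apply: (@connected_split _ _ (B `&` L)); rewrite -?BE -?IE //; exact: closedI.
- apply: continuum_seqR; [|exact: compact_closedI|].
    by exists x; split=> //; case: (BKL x Bx).
  apply: (@connected_split _ _ (B `&` K)); [exact: closedI|exact: closedI| |].
    by rewrite setUC -BE.
  by rewrite setIC -IE.
- by split; [exact: subIsetl|move=> /(_ x Bx)[]].
- by split; [exact: subIsetl|move=> /(_ y By)[]].
Qed.

Lemma connected_subsingleton (T : topologicalType) (A : set T) :
  (forall x y : T, A x -> A y -> x = y) -> connected A.
Proof.
move=> H; have [[x Ax]|nA] := pselect (A !=set0).
  rewrite (_ : A = [set x]); first exact: connected1.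
  by apply/seteqP; split=> [y Ay|y ->//]; exact: H.
rewrite (_ : A = set0); first exact: connected0.
by apply/seteqP; split=> // y Ay; apply: nA; exists y.
Qed.

Section Comb.
Variables (D : set (seqR R)) (S : set R).
Hypothesis DS : comb D S.

(** The level [u] is attained at one point at most: the coordinates before [k]
vanish since [u] is not in [S], and those after [k] are prescribed. *)
Lemma decomposable_cut B k u x y : B `<=` D -> continuum R B -> 0 < u -> ~ S u ->
  (forall v w, B v -> B w -> u <= v k -> u <= w k ->
     forall j, (k < j)%N -> v j = w j) ->
  B x -> x k < u -> B y -> u < y k -> decomposable R B.
Proof.
move=> BD cB u0 nSu tl Bx xu By yu.
apply: (@decomposable_split B [set v : seqR R | u <= v k] [set v : seqR R | v k <= u] x y) => //.
- by apply: (closed_coord (A := [set t | u <= t])); exact: closed_ge.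
- by apply: (closed_coord (A := [set t | t <= u])); exact: closed_le.
- by move=> v _ /=; case: (leP u (v k)) => h; [left|right; exact: ltW].
- apply: connected_subsingleton => v w [[Bv /= v1] v2] [[Bw /= w1] w2].
  have vk : v k = u by apply/eqP; rewrite eq_le v1 v2.
  have wk : w k = u by apply/eqP; rewrite eq_le w1 w2.
  apply: functional_extensionality_dep => j; case: (ltngtP j k) => jk.
  + by rewrite (comb_below DS (BD v Bv) _ jk) ?vk // (comb_below DS (BD w Bw) _ jk) ?wk.
  + exact: tl.
  + by rewrite jk vk wk.
- by move=> /=; rewrite leNgt xu.
- by move=> /=; rewrite leNgt yu.
Qed.

Lemma comb_rooted B w i s : B `<=` D -> closed B -> connected B ->
  B (fun _ => 0) -> B w -> 0 <= s <= w i -> B (trunc i s w).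
Proof.
have [S0 _ D0 _] := DS.
move=> BD cB kB B0 Bw sI; have [wi|wi] := ltP 0 (w i).
  apply: (comb_segment DS BD cB kB Bw B0 (a := 0)) => //; first by rewrite lexx.
  by move=> [/=]; rewrite ltxx.
have wi0 : w i = 0 by apply/eqP; rewrite eq_le wi D0 //; exact: BD.
have s0 : s = 0 by apply/eqP; rewrite eq_le; lra.
rewrite (_ : trunc i s w = w) //; apply: functional_extensionality_dep => j.
rewrite /trunc; case: ifP => ji; last by case: eqP => // ->; rewrite s0 wi0.
rewrite (comb_below DS (BD w Bw) _ ji) // wi0 => /S0; by rewrite ltxx.
Qed.

(** The [j]-th coordinate maps the connected set [B] into [S], which contains no
interval. *)
Lemma comb_tail_constant B k j : B `<=` D -> connected B ->
  (forall v, B v -> 0 < v k) -> (k < j)%N ->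
  forall v w, B v -> B w -> v j = w j.
Proof.
have [S0 Sd _ _] := DS.
move=> BD kB Bk kj.
have le v w : B v -> B w -> w j <= v j.
  move=> Bv Bw; rewrite leNgt; apply/negP => vw.
  have [e /andP[ve ew] nSe] := Sd _ _ vw.
  have : B `<=` [set z : seqR R | z j < e].
    apply: (@connected_clopen _ _ _ [set z : seqR R | z j <= e]) => //.
    - exact: open_coord_lt.
    - by apply: (closed_coord (A := [set t | t <= e])); exact: closed_le.
    - move=> z Bz /=; split; first exact: ltW.
      rewrite le_eqVlt => /orP[/eqP E|//]; case: nSe; rewrite -E.
      exact: (comb_up DS (BD z Bz) (Bk z Bz)).
    - by exists v.
  by move=> /(_ w Bw) /=; rewrite ltNge ltW.
by move=> v w Bv Bw; apply/eqP; rewrite eq_le !le.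
Qed.

Lemma comb_away_from_root B : B `<=` D -> closed B -> ~ B (fun _ => 0) ->
  exists k, forall v, B v -> 0 < v k.
Proof.
have [S0 _ D0 _] := DS.
move=> BD cB nB0; apply: contrapT => h; apply: nB0; apply: closed_seqP => // J e e0.
have [v Bv vJ] : exists2 v, B v & v J = 0.
  apply: contrapT => h'; apply: h; exists J => v Bv.
  by rewrite lt_neqAle D0 ?andbT; [apply/eqP => E; apply: h'; exists v|exact: BD].
exists v => // j jJ; rewrite (comb_below DS (BD v Bv) _ jJ) ?subrr ?normr0 //.
by rewrite vJ => /S0; rewrite ltxx.
Qed.

(** Away from the root some coordinate is positive on all of [B], so that all
later ones are constant on [B]; cut along the last coordinate that varies. *)
Lemma decomposable_rootless B : B `<=` D -> continuum R B -> Defs.nondegenerate B ->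
  ~ B (fun _ => 0) -> decomposable R B.
Proof.
have [S0 Sd D0 _] := DS.
move=> BD cB [p [q [Bp Bq pq]]] nB0; have [B0 cpB kB _] := cB.
have clB : closed B by apply: compact_closed => //; exact: seqR_hausdorff.
have [i Bi] := comb_away_from_root BD clB nB0.
pose const k := forall v w j, B v -> B w -> (k <= j)%N -> v j = w j.
have ex : exists k, `[< const k >].
  by exists i.+1; apply/asboolP => v w j Bv Bw ij; exact: (comb_tail_constant BD kB Bi).
case: (ex_minnP ex) => -[|k] /asboolP ck mink.
  case: pq; apply: functional_extensionality_dep => j; exact: ck.
have [v [w [Bv Bw vw]]] : exists v w, [/\ B v, B w & v k < w k].
  apply: contrapT => h.
  suff /asboolP/mink : const k by rewrite ltnn.
  move=> v w j Bv Bw; rewrite leq_eqVlt => /orP[/eqP<-|]; last exact: ck.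
  by apply: contrapT => /eqP; rewrite neq_lt => /orP[vw|wv]; apply: h; [exists v, w|exists w, v].
have [u /andP[vu uw] nSu] := Sd _ _ vw.
apply: (@decomposable_cut B k u v w) => //.
  by apply: le_lt_trans vu; apply: D0; exact: BD.
by move=> x y Bx By _ _ j kj; exact: ck.
Qed.

(** Take a coordinate [i] that is positive somewhere on [B].  If the points of [B]
with positive [i]-th coordinate agree after [i], cut along that coordinate.
Otherwise they are split by a bound [e] outside [S] on a later coordinate [j];
adding the set where coordinate [i] vanishes to both sides gives closed sets
that intersect exactly in it, and it is star-shaped about the root. *)
Lemma decomposable_rooted B : B `<=` D -> continuum R B -> Defs.nondegenerate B ->
  B (fun _ => 0) -> decomposable R B.
Proof.
have [S0 Sd D0 _] := DS.
move=> BD cB [p [q [Bp Bq pq]]] Br; have [B0 cpB kB _] := cB.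
have clB : closed B by apply: compact_closed => //; exact: seqR_hausdorff.
have [w [i [Bw wi]]] : exists w i, B w /\ 0 < w i.
  apply: contrapT => h; apply: pq; apply: functional_extensionality_dep => j.
  have z v : B v -> v j = 0.
    move=> Bv; apply/eqP; rewrite eq_le D0 ?andbT; last exact: BD.
    by rewrite leNgt; apply/negP => vj; apply: h; exists v, j.
  by rewrite !z.
have [tl|ntl] := pselect (forall v w, B v -> B w -> 0 < v i -> 0 < w i ->
    forall j, (i < j)%N -> v j = w j).
  have [u /andP[u0 uw] nSu] := Sd _ _ wi.
  apply: (@decomposable_cut B i u (fun _ => 0) w) => //.
  by move=> x y Bx By ux uy; apply: tl => //; lra.
have [v [{}w [j [Bv {}Bw vi {}wi ijvw]]]] : exists v w j,
    [/\ B v, B w, 0 < v i, 0 < w i & (i < j)%N /\ v j < w j].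
  apply: contrapT => h; apply: ntl => v' w' Bv' Bw' vi' wi' j ij.
  apply: contrapT => /eqP; rewrite neq_lt => /orP[lt|lt]; apply: h.
    by exists v', w', j; split.
  by exists w', v', j; split.
have [ij vw] := ijvw; have [e /andP[ve ew] nSe] := Sd _ _ vw.
pose Z : set (seqR R) := [set x | x i <= 0].
have cZ : closed Z by apply: (closed_coord (A := [set t | t <= 0])); exact: closed_le.
apply: (@decomposable_split B (Z `|` [set x : seqR R | e <= x j])
  (Z `|` [set x : seqR R | x j <= e]) v w) => //.
- by apply: closedU => //; apply: (closed_coord (A := [set t | e <= t])); exact: closed_ge.
- by apply: closedU => //; apply: (closed_coord (A := [set t | t <= e])); exact: closed_le.
- by move=> x _; have [h|h] := leP e (x j); [left|right]; right => //=; exact: ltW.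
- have -> : B `&` (Z `|` [set x : seqR R | e <= x j]) `&`
      (Z `|` [set x : seqR R | x j <= e]) = B `&` Z.
    apply/seteqP; split=> [x [[Bx h1] h2]|x [Bx Zx]]; last by split; [split|]=> //; left.
    split=> //; rewrite /Z /= leNgt; apply/negP => xi.
    have Sx := comb_up DS (BD x Bx) xi ij.
    case: h1 => [|h1]; first by rewrite /Z /= leNgt xi.
    case: h2 => [|h2]; first by rewrite /Z /= leNgt xi.
    by apply: nSe; rewrite (_ : e = x j) //; apply/eqP; rewrite eq_le h1 h2.
  apply: star_connected.
  + exact: closedI.
  + by move=> x k [Bx _]; apply: D0; exact: BD.
  + by split=> //=; rewrite /Z /=.
  + move=> x k s [Bx Zx] sI; split; first exact: comb_rooted.
    rewrite /Z /= /trunc; case: ifP => // _; case: eqP => [ik|//].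
    by move: Zx; rewrite /Z /= ik; lra.
- by move=> [|]; rewrite /Z /= leNgt ?vi ?ve.
- by move=> [|]; rewrite /Z /= leNgt ?wi ?ew.
Qed.

Lemma comb_hereditarily_decomposable : hereditarily_decomposable R D.
Proof.
move=> B BD cB nB; have [Br|Br] := pselect (B (fun _ => 0)).
  exact: decomposable_rooted.
exact: decomposable_rootless.
Qed.

End Comb.

(** On a subcontinuum, which is compact, [h] is a homeomorphism onto its image. *)
Lemma hereditarily_decomposable_injective X (h : seqR R -> seqR R) :
  {within X, continuous h} -> set_inj X h ->
  hereditarily_decomposable R (h @` X) -> hereditarily_decomposable R X.
Proof.
move=> hc hi hd B BX cB [p [q [Bp Bq pq]]]; have [B0 cpB kB _] := cB.
have hcB : {within B, continuous h} by exact: continuous_subspaceW hc.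
have hiB : set_inj B h by move=> x y /set_mem Bx /set_mem By; apply: hi; rewrite inE; exact: BX.
have [k [_ _ [kh hk] _ kc]] := injective_homeomorphism B0 cpB (@seqR_hausdorff R) hcB hiB.
have [|||K [L [[K0 cK kK _] [L0 cL kL _] [KB nK] [LB nL] KL]]] := hd (h @` B).
- by move=> _ [x Bx <-]; exists x => //; exact: BX.
- apply: continuum_seqR.
  + by exists (h p), p.
  + exact: continuous_compact.
  + exact: connected_continuous_connected.
- exists (h p), (h q); split; [by exists p|by exists q|].
  by move=> E; apply: pq; rewrite -(kh p Bp) E kh.
have piece M : M !=set0 -> compact M -> connected M -> M `<=` h @` B ->
    continuum R (k @` M).
  move=> [m Mm] cM kM MB; have kcM : {within M, continuous k} by exact: continuous_subspaceW kc.
  apply: continuum_seqR; first by exists (k m), m.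
    exact: continuous_compact.
  exact: connected_continuous_connected.
have sub M : M `<=` h @` B -> ~ (h @` B `<=` M) -> k @` M `<` B.
  move=> MB nM; split=> [_ [m Mm <-]|BM].
    by have [b Bb <-] := MB m Mm; rewrite kh.
  apply: nM => _ [b Bb <-]; have [m Mm kmb] := BM b Bb.
  by rewrite -kmb hk //; exact: MB.
exists (k @` K), (k @` L); split.
- exact: piece.
- exact: piece.
- exact: sub.
- exact: sub.
rewrite -image_setU -KL; apply/seteqP; split=> [b Bb|_ [_ [b Bb <-] <-]]; last by rewrite kh.
by exists (h b); [exists b|rewrite kh].
Qed.

End Decomposition.

(** * Arcs and their concatenation *)
Section Arcs.
Variables (R : realType) (T : topologicalType).
Hypothesis hT : hausdorff_space T.
Implicit Types (x y m : T) (K : set T).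

Lemma within_continuous_compose (S1 S2 S3 : topologicalType) (A : set S1) (B : set S2)
    (h : S1 -> S2) (g : S2 -> S3) :
  {within A, continuous h} -> {within B, continuous g} ->
  (forall s, A s -> B (h s)) -> {within A, continuous (g \o h)}.
Proof.
move=> hc gc AB; apply/subspace_continuousP => s As V nV.
have := within_comp_nbhs hc As (within_comp_nbhs gc (AB s As) nV).
by apply: filterS => r /= H Ar; apply: (H Ar); exact: AB.
Qed.

Lemma arc_between_injective (h : R -> T) :
  {within `[0, 1], continuous h} -> set_inj `[0, 1]%classic h ->
  arc_between R (h 0) (h 1) (h @` `[0, 1]%classic).
Proof.
move=> hc hi; have I0 : (`[0, 1]%classic : set R) !=set0.
  by exists 0; rewrite /= in_itv /= lexx ler01.
by have [k hk] := injective_homeomorphism I0 (@segment_compact R 0 1) hT hc hi; exists h, k.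
Qed.

Lemma arc_betweenP x y K : arc_between R x y K -> exists h : R -> T,
  [/\ {within `[0, 1], continuous h}, set_inj `[0, 1]%classic h,
      h 0 = x, h 1 = y & K = h @` `[0, 1]%classic].
Proof.
move=> [h [k [[hK kI [kh hk] hc kc] h0 h1]]]; exists h; split=> //.
  by move=> s t /set_mem Is /set_mem It E; rewrite -(kh s Is) E kh.
apply/seteqP; split=> [z Kz|_ [t It <-]]; last exact: hK.
by exists (k z); [exact: kI|exact: hk].
Qed.

Lemma arc_between_rev x y K : arc_between R x y K -> arc_between R y x K.
Proof.
move=> /arc_betweenP[h [hc hi h0 h1 ->]].
have I1 (s : R) : (`[0, 1]%classic : set R) s -> (`[0, 1]%classic : set R) (1 - s).
  by rewrite /= !in_itv /=; lra.
have -> : h @` `[0, 1]%classic = (fun t : R => h (1 - t)) @` `[0, 1]%classic.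
  apply/seteqP; split=> _ [t It <-]; exists (1 - t); rewrite ?subKr //; exact: I1.
pose g t := h (1 - t); rewrite -[image _ _]/(g @` _).
have <- : g 0 = y by rewrite /g subr0.
have <- : g 1 = x by rewrite /g subrr.
apply: arc_between_injective.
  apply: (within_continuous_compose (h := fun t : R => 1 - t) _ hc) => //.
  apply: continuous_subspaceT => t; apply: cvgB; [exact: cvg_cst|exact: cvg_id].
move=> s t /set_mem Is /set_mem It /hi; rewrite !inE => /(_ (I1 s Is) (I1 t It)).
by lra.
Qed.

Lemma arc_between_cat x m y K L : arc_between R x m K ->
  arc_between R m y L -> K `&` L `<=` [set m] ->
  arc_between R x y (K `|` L).
Proof.
move=> /arc_betweenP[h1 [h1c h1i h10 h11 KE]] /arc_betweenP[h2 [h2c h2i h20 h21 LE]] KL.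
pose h (t : R) := if t <= 2^-1 then h1 (2 * t) else h2 (2 * t - 1).
have hl t : t <= 2^-1 -> h t = h1 (2 * t) by rewrite /h => ->.
have hr t : 2^-1 <= t -> h t = h2 (2 * t - 1).
  rewrite /h; case: (leP t 2^-1) => // t1 t2.
  have -> : t = 2^-1 by lra.
  by rewrite mulfV ?subrr ?h20.
have Il (t : R) : `[0, 2^-1]%classic t -> (`[0, 1]%classic : set R) (2 * t).
  by rewrite /= !in_itv /=; lra.
have Ir (t : R) : `[2^-1, 1]%classic t -> (`[0, 1]%classic : set R) (2 * t - 1).
  by rewrite /= !in_itv /=; lra.
have I0 : (`[0, 1]%classic : set R) 0 by rewrite /= in_itv /= lexx ler01.
have I1 : (`[0, 1]%classic : set R) 1 by rewrite /= in_itv /= lexx ler01.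
have IU : `[0, 1]%classic = `[0, 2^-1]%classic `|` `[2^-1, 1]%classic :> set R.
  apply/seteqP; split=> t /=; rewrite !in_itv /= => tI; last by case: tI; lra.
  by case: (leP t 2^-1) => ?; [left|right]; lra.
have hKL : h @` `[0, 1]%classic = K `|` L.
  rewrite IU image_setU KE LE; congr (_ `|` _); apply/seteqP; split=> _ [t tI <-].
  - by exists (2 * t); [exact: Il|rewrite hl //; move: tI; rewrite /= in_itv /=; lra].
  - move: tI; rewrite /= in_itv /= => tI; exists (t / 2); first by rewrite /= in_itv /=; lra.
    by rewrite hl; [congr h1; lra|lra].
  - by exists (2 * t - 1); [exact: Ir|rewrite hr //; move: tI; rewrite /= in_itv /=; lra].
  - move: tI; rewrite /= in_itv /= => tI; exists ((t + 1) / 2); first by rewrite /= in_itv /=; lra.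
    by rewrite hr; [congr h2; lra|lra].
have <- : h 0 = x by rewrite hl ?mulr0 //; lra.
have <- : h 1 = y by rewrite hr; [rewrite -h21; congr h2|]; lra.
rewrite -hKL; apply: arc_between_injective.
  rewrite IU; apply: withinU_continuous; [exact: interval_closed|exact: interval_closed| |].
    apply: (@within_continuous_eq _ _ _ (h1 \o (fun t : R => 2 * t))).
      apply: (within_continuous_compose (h := fun t : R => 2 * t) _ h1c) => //.
      by apply: continuous_subspaceT => t; apply: cvgM; [exact: cvg_cst|exact: cvg_id].
    by move=> t; rewrite /= in_itv /= => /andP[_ t1]; rewrite hl.
  apply: (@within_continuous_eq _ _ _ (h2 \o (fun t : R => 2 * t - 1))).
    apply: (within_continuous_compose (h := fun t : R => 2 * t - 1) _ h2c) => //.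
    apply: continuous_subspaceT => t; apply: cvgB; last exact: cvg_cst.
    by apply: cvgM; [exact: cvg_cst|exact: cvg_id].
  by move=> t; rewrite /= in_itv /= => /andP[t1 _]; rewrite hr.
have mix (s t : R) : `[0, 2^-1]%classic s -> `[2^-1, 1]%classic t -> h s = h t -> s = t.
  move=> sI tI E; have := Il s sI; have := Ir t tI => t1 s1.
  move: (sI) (tI); rewrite /= !in_itv /= => /andP[s2 s3] /andP[t2 t3].
  have Em : h1 (2 * s) = m.
    apply: KL; split; first by rewrite KE; exists (2 * s).
    by rewrite -hl // E hr // LE; exists (2 * t - 1).
  have E1 : 2 * s = 1.
    by apply: h1i; rewrite ?inE // Em h11.
  have E2 : 2 * t - 1 = 0.
    by apply: h2i; rewrite ?inE // h20 -hr // -E hl.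
  by lra.
move=> s t /set_mem; rewrite IU => sI /set_mem tI E; case: sI tI => sI [] tI.
- move: (sI) (tI); rewrite /= !in_itv /= => /andP[s2 s3] /andP[t2 t3].
  have : 2 * s = 2 * t by apply: h1i; rewrite ?inE -?hl //; exact: Il.
  by lra.
- exact: mix.
- by apply/esym/mix.
- move: (sI) (tI); rewrite /= !in_itv /= => /andP[s2 s3] /andP[t2 t3].
  have : 2 * s - 1 = 2 * t - 1 by apply: h2i; rewrite ?inE -?hr //; exact: Ir.
  by lra.
Qed.

(** Allowing a single point lets paths be concatenated without deciding whether
their ends coincide. *)
Definition path_between x y K := (x = y /\ K = [set x]) \/ arc_between R x y K.

Lemma path_between_ends x y K : path_between x y K -> K x /\ K y.
Proof.
move=> [[-> ->]//|/arc_betweenP[h [_ _ <- <- ->]]].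
by split; [exists 0|exists 1] => //; rewrite /= in_itv /= lexx ler01.
Qed.

Lemma path_between_rev x y K : path_between x y K -> path_between y x K.
Proof. by move=> [[-> ->]|/arc_between_rev]; [left|right]. Qed.

Lemma path_between_cat x m y K L : path_between x m K -> path_between m y L ->
  K `&` L `<=` [set m] -> path_between x y (K `|` L).
Proof.
move=> pK pL KL; have [_ Km] := path_between_ends pK; have [Lm _] := path_between_ends pL.
case: pK => [[-> ->]|aK].
  by rewrite (_ : _ `|` _ = L) //; apply/seteqP; split=> [z [->|]|z]//; right.
case: pL => [[<- ->]|aL].
  by right; rewrite (_ : _ `|` _ = K) //; apply/seteqP; split=> [z [|->]|z]//; left.
by right; exact: arc_between_cat aK aL KL.
Qed.

(** In the parameter interval, a connected set containing [0] and [1] is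
everything. *)
Lemma arc_between_minimal x y K L : arc_between R x y K ->
  connected L -> L x -> L y -> L `<=` K -> L = K.
Proof.
move=> [h [k [[hK kI [kh hk] hc kc] h0 h1]]] kL Lx Ly LK.
apply/seteqP; split=> // z Kz.
have kLc : connected (k @` L).
  apply: connected_continuous_connected => //; exact: continuous_subspaceW kc.
have I0 : `[0, 1]%classic (0 : R) by rewrite /= in_itv /= lexx ler01.
have I1 : `[0, 1]%classic (1 : R) by rewrite /= in_itv /= lexx ler01.
have [u Lu kuz] : (k @` L) (k z).
  apply: ((connected_intervalP _).1 kLc 0 1).
  - by exists x => //; rewrite -h0 kh.
  - by exists y => //; rewrite -h1 kh.
  - by have := kI z Kz; rewrite /= in_itv.
by rewrite -(hk z Kz) -kuz hk //; exact: LK.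
Qed.

End Arcs.

(** * Combs over a finite set are trees *)
Section FiniteArcs.
Variables (R : realType) (T : topologicalType).
Implicit Types A B : set T.

Definition finite_arcs A := exists (n : nat) (K : nat -> set T),
  (forall i, (i < n)%N -> Defs.arc R (K i)) /\ A = \bigcup_(i < n) K i.

Lemma finite_arcs0 : finite_arcs set0.
Proof.
exists 0%N, (fun _ => set0); split=> //.
by apply/seteqP; split=> // x [i /=]; rewrite ltn0.
Qed.

Lemma finite_arcs1 A : Defs.arc R A -> finite_arcs A.
Proof.
move=> aA; exists 1%N, (fun _ => A); split=> //.
by apply/seteqP; split=> [x Ax|x [i _]//]; exists 0%N.
Qed.

Lemma finite_arcsU A B : finite_arcs A -> finite_arcs B -> finite_arcs (A `|` B).
Proof.
move=> [n [K [aK ->]]] [m [L [aL ->]]].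
exists (n + m)%N, (fun i => if (i < n)%N then K i else L (i - n)%N); split.
  move=> i inm; case: (ltnP i n) => [|ni]; first exact: aK.
  by apply: aL; rewrite ltn_subLR.
apply/seteqP; split=> [x [[i /= im Kx]|[i /= im Lx]]|x [i /= inm]].
- by exists i; [rewrite /= ltn_addr|rewrite im].
- exists (n + i)%N; first by rewrite /= ltn_add2l.
  by rewrite ltnNge leq_addr /= addKn.
- case: (ltnP i n) => ni H; first by left; exists i.
  by right; exists (i - n)%N => //=; rewrite ltn_subLR.
Qed.

Lemma finite_arcs_bigcup (I : eqType) (E : set I) (A : I -> set T) :
  finite_set E -> (forall i, E i -> finite_arcs (A i)) ->
  finite_arcs (\bigcup_(i in E) A i).
Proof.
move=> /finite_seqP[s ->]; elim: s => [|i s IH] H.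
  rewrite (_ : \bigcup_(i in _) _ = set0); first exact: finite_arcs0.
  by apply/seteqP; split=> // x [].
rewrite (_ : \bigcup_(j in _) _ = A i `|` \bigcup_(j in [set` s]) A j).
  apply: finite_arcsU; first by apply: H; rewrite /= mem_head.
  by apply: IH => j js; apply: H; rewrite /= inE js orbT.
apply/seteqP; split=> [x [j /=]|x].
  by rewrite inE => /orP[/eqP->|js] Ax; [left|right; exists j].
by case=> [Ax|[j /= js Ax]]; [exists i|exists j] => //=; rewrite inE ?eqxx ?js ?orbT.
Qed.

End FiniteArcs.

Section CombTree.
Variable R : realType.
Implicit Types (B : set (seqR R)) (v w x y : seqR R).

Lemma finite_not_interval (S : set R) a b : finite_set S -> a < b ->
  exists2 c, a < c < b & ~ S c.
Proof.
move=> /finite_seqP[s ->] {S}; elim: s a b => [|t s IH] a b ab.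
  by exists ((a + b) / 2) => //=; lra.
have [at_|ta] := ltP a t.
  have [|c /andP[ac]] := IH a (Num.min t b); first by rewrite lt_min at_.
  rewrite lt_min => /andP[ct cb] cs; exists c; first by rewrite ac.
  by rewrite /= inE => /orP[/eqP E|//]; rewrite E ltxx in ct.
have [c /andP[ac cb] cs] := IH a b ab; exists c; first by rewrite ac.
rewrite /= inE => /orP[/eqP E|//].
by rewrite E ltNge ta in ac.
Qed.

Lemma finite_sequences (F : set R) M (r : seqR R) : finite_set F ->
  finite_set [set v : seqR R | (forall j, (j < M)%N -> F (v j)) /\
                               (forall j, (M <= j)%N -> v j = r j)].
Proof.
move=> fF; elim: M r => [|M IH] r.
  rewrite (_ : [set _ | _] = [set r]); first exact: finite_set1.
  apply/seteqP; split=> [v [_ vr]|v ->]; last by split.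
  by apply: functional_extensionality_dep => j; exact: vr.
pose r' (a : R) : seqR R := fun j => if j == M then a else r j.
have := @bigcup_finite _ _ F (fun a => [set v : seqR R |
  (forall j, (j < M)%N -> F (v j)) /\ (forall j, (M <= j)%N -> v j = r' a j)]) fF
  (fun a _ => IH (r' a)).
apply: sub_finite_set => v [vF vr]; exists (v M); first exact: vF.
split=> [j jM|j]; first by apply: vF; rewrite ltnW.
by rewrite leq_eqVlt /r' => /orP[/eqP<-|Mj]; rewrite ?eqxx // gtn_eqF // vr.
Qed.

Lemma segment_arc i w a b : a < b ->
  arc_between R (trunc i a w) (trunc i b w) [set trunc i s w | s in `[a, b]%classic].
Proof.
move=> ab; pose h t := trunc i (a + t * (b - a)) w.
have hI : h @` `[0, 1]%classic = [set trunc i s w | s in `[a, b]%classic].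
  apply/seteqP; split=> _ [t tI <-]; move: tI; rewrite /= in_itv /= => /andP[t0 t1].
    by exists (a + t * (b - a)) => //=; rewrite in_itv /=; nra.
  exists ((t - a) / (b - a)); last by rewrite /h divfK ?subrKC //; lra.
  by rewrite /= in_itv /= divr_ge0 ?ler_pdivrMr; lra.
have <- : h 0 = trunc i a w by rewrite /h mul0r addr0.
have <- : h 1 = trunc i b w by rewrite /h mul1r subrKC.
rewrite -hI; apply: (arc_between_injective (@seqR_hausdorff R)).
  apply: (within_continuous_compose (h := fun t : R => a + t * (b - a)) _
    (@trunc_continuous R i w setT)) => //.
  apply: continuous_subspaceT => t; apply: cvgD; first exact: cvg_cst.
  by apply: cvgM; [exact: cvg_id|exact: cvg_cst].
move=> s t _ _ /(congr1 (fun v : seqR R => v i)); rewrite /h !truncE => E.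
have ba : b - a != 0 by lra.
by apply: (mulIf ba); lra.
Qed.

Variables (D : set (seqR R)) (S : set R) (n : nat).
Hypothesis DS : comb D S.
Hypothesis Dt : forall v i s, D v -> (i <= n)%N -> 0 <= s <= v i -> D (trunc i s v).
Hypothesis Dn : forall v w j, D v -> D w -> (n < j)%N -> v j = w j.

(** Minimality among closed connected sets yields uniqueness of arcs; agreement
with [x] from coordinate [i] on ensures that concatenated geodesics meet only at
their common end. *)
Definition geodesic i x y K := [/\ path_between R x y K, K `<=` D,
  forall v j, K v -> (i <= j)%N -> v j = x j &
  forall B, B `<=` D -> closed B -> connected B -> B x -> B y -> K `<=` B].

Lemma geodesic_rev i x y K : (forall j, (i <= j)%N -> x j = y j) ->
  geodesic i x y K -> geodesic i y x K.
Proof.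
move=> xy [pK KD Ki KB]; split=> //.
- refine (path_between_rev (@seqR_hausdorff R) pK).
- by move=> v j Kv ij; rewrite (Ki v j) // xy.
- by move=> B BD cB kB By Bx; exact: KB.
Qed.

(** Go down from [x] to the point of its branch with zeros before [i], along
coordinate [i] up to level [y i], then up to [y].  The middle segment lies in
every closed connected set containing [x] and [y] by [comb_segment], and hence
so do its ends, which brings in the other two pieces. *)
Lemma geodesic_step i x y :
  (forall x y, D x -> D y -> (forall j, (i <= j)%N -> x j = y j) ->
     exists K, geodesic i x y K) ->
  (i <= n)%N -> D x -> D y -> x i < y i -> (forall j, (i < j)%N -> x j = y j) ->
  exists K, geodesic i.+1 x y K.
Proof.
have [_ _ D0 _] := DS.
move=> IH iM Dx Dy xyi xy.
have hT := @seqR_hausdorff R.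
pose m := trunc i (x i) y; pose m' := trunc i (y i) y.
have Dseg s : x i <= s <= y i -> D (trunc i s y).
  move=> /andP[xs sy]; apply: Dt => //; rewrite sy (le_trans _ xs) //; exact: D0.
have Dm : D m by apply: Dseg; rewrite lexx ltW.
have Dm' : D m' by apply: Dseg; rewrite lexx ltW.
have xm j : (i <= j)%N -> x j = m j.
  by rewrite leq_eqVlt => /orP[/eqP<-|ij]; rewrite /m ?truncE // trunc_gt // xy.
have my j : (i <= j)%N -> m' j = y j.
  by rewrite leq_eqVlt => /orP[/eqP<-|ij]; rewrite /m' ?truncE // trunc_gt.
have [K1 [p1 K1D K1i K1B]] := IH x m Dx Dm xm.
have [K3 [p3 K3D K3i K3B]] := IH m' y Dm' Dy my.
pose K2 := [set trunc i s y | s in `[x i, y i]%classic].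
have K2a : arc_between R m m' K2 by exact: segment_arc.
have m'i : m' i = y i by rewrite /m' truncE.
exists ((K1 `|` K2) `|` K3); split.
- apply: (path_between_cat hT (m := m') _ p3).
    apply: (path_between_cat hT p1); first by right.
    move=> v [K1v [s sI sv]]; have := K1i v i K1v (leqnn i).
    by rewrite -sv truncE => ->.
  move=> v [[K1v|[s sI sv]] K3v]; have vi := K3i v i K3v (leqnn i); rewrite m'i in vi.
    by move: xyi; rewrite -vi (K1i v i K1v (leqnn i)) ltxx.
  by move: vi; rewrite -sv truncE => ->.
- move=> v [[/K1D//|[s sI <-]]|/K3D//].
  by apply: Dseg; move: sI; rewrite /= in_itv.
- move=> v j [[K1v|[s sI <-]]|K3v] ij.
  + by apply: K1i => //; exact: ltnW.
  + by rewrite trunc_gt // xy.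
  + by rewrite (K3i v j K3v (ltnW ij)) /m' trunc_gt // xy.
move=> B BD cB kB Bx By.
have K2B : K2 `<=` B.
  move=> _ [s sI <-]; apply: (comb_segment DS BD cB kB By Bx (a := x i)).
  - by rewrite D0.
  - by rewrite ltxx => -[].
  - by move: sI; rewrite /= in_itv.
have [K2m K2m'] := path_between_ends (or_intror K2a).
move=> v [[K1v|K2v]|K3v]; [|exact: K2B|].
- by apply: (K1B B) => //; exact: K2B.
- by apply: (K3B B) => //; exact: K2B.
Qed.

Lemma geodesic_exists i x y : (i <= n.+1)%N -> D x -> D y ->
  (forall j, (i <= j)%N -> x j = y j) -> exists K, geodesic i x y K.
Proof.
elim: i x y => [|i IH] x y iM Dx Dy xy.
  have -> : x = y by apply: functional_extensionality_dep => j; exact: xy.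
  exists [set y]; split; [by left|by move=> _ ->|by move=> _ j ->|by move=> B _ _ _ _ By _ ->].
have IH' x' y' := IH x' y' (ltnW iM).
case: (ltgtP (x i) (y i)) => xyi.
- exact: geodesic_step.
- have [j ij|K gK] := geodesic_step IH' iM Dy Dx xyi.
    by rewrite xy.
  by exists K; apply: geodesic_rev gK => j ij; rewrite xy.
- have [j|K [pK KD Ki KB]] := IH' x y Dx Dy.
    by rewrite leq_eqVlt => /orP[/eqP<-//|]; exact: xy.
  by exists K; split=> // v j Kv ij; apply: Ki => //; exact: ltnW.
Qed.

(** A geodesic is contained in every other arc with the same ends, and an arc has
no proper connected subset containing both of its ends. *)
Lemma comb_uniquely_arcwise_connected : uniquely_arcwise_connected R D.
Proof.
move=> x y Dx Dy xy.
have [j nj|K [[[]//|aK] KD _ KB]] := @geodesic_exists n.+1 x y (leqnn _) Dx Dy.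
  exact: Dn.
exists K; split=> // K' [K'D aK'].
have [h [hc _ h0 h1 K'E]] := arc_betweenP aK'.
have [Kx Ky] := path_between_ends (or_intror aK).
have [K'x K'y] := path_between_ends (or_intror aK').
have [g [gc _ _ _ KE]] := arc_betweenP aK.
have kI : connected (`[0, 1]%classic : set R).
  by apply/connected_intervalP; exact: interval_is_interval.
apply: (arc_between_minimal aK') => //.
  by rewrite KE; exact: connected_continuous_connected.
apply: KB => //.
  apply: compact_closed; first exact: seqR_hausdorff.
  by rewrite K'E; apply: continuous_compact => //; exact: segment_compact.
by rewrite K'E; exact: connected_continuous_connected.
Qed.

(** By compactness there is a highest point among those that agree with the
branch, and the points below it on the branch form a segment. *)
Lemma comb_branch k v : compact D -> D v -> (k <= n)%N -> 0 < v k ->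
  Defs.arc R (D `&` [set u : seqR R | forall j, j != k -> u j = trunc k 0 v j]).
Proof.
have [_ _ D0 _] := DS.
move=> cD Dv kn vk; set E := D `&` _.
have cE : compact E.
  apply: compact_closedI => //.
  rewrite (_ : [set _ | _] = \bigcap_(j in [set j | j != k])
      [set u : seqR R | [set trunc k 0 v j] (u j)]); last by [].
  by apply: closed_bigI => j _; apply: closed_coord; exact: closed_eq.
have trE s : 0 <= s -> D (trunc k s v) -> E (trunc k s v).
  by move=> s0 Ds; split=> // j jk; rewrite /trunc (negbTE jk).
have Ev : E (trunc k (v k) v).
  by apply: trE; [exact: ltW|apply: Dt => //; rewrite lexx ltW].
have kc : {within E, continuous (fun u : seqR R => u k)}.
  by apply: continuous_subspaceT; exact: (@prod_coord_continuous (fun _ => R)).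
have [c /set_mem[Dc Ec] cmax] := compact_EVT_max (ex_intro _ _ Ev) cE kc.
have ck : 0 < c k.
  by apply: lt_le_trans vk _; rewrite -[v k](truncE k _ v); apply: cmax; rewrite inE.
have [h [g [hom _ _]]] := segment_arc k v ck.
exists h, g; rewrite (_ : E = [set trunc k s v | s in `[0, c k]%classic]) //.
apply/seteqP; split=> [u [Du Eu]|u [s]].
  exists (u k).
    by rewrite /= in_itv /= D0 //= cmax // inE.
  apply: functional_extensionality_dep => j; have [->|jk] := eqVneq j k.
    by rewrite truncE.
  by rewrite (Eu j jk) /trunc (negbTE jk).
rewrite /= in_itv /= => sI us; rewrite -us; apply: trE; first by case/andP: sI.
have -> : trunc k s v = trunc k s c; last exact: Dt.
apply: functional_extensionality_dep => j; rewrite /trunc.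
by case: ltnP => // kj; case: eqP => // /eqP jk; rewrite (Ec j jk) /trunc ltnNge kj /= (negbTE jk).
Qed.

(** A point belongs to the branch of its first positive coordinate, and a branch
is determined by that index and the coordinates after it, which are taken from
a finite set up to [n] and are prescribed beyond.  A point with zeros up to [n]
is at the bottom of a branch of coordinate [n]. *)
Lemma comb_finite_arcs : finite_set S -> compact D ->
  (exists2 w, D w & 0 < w n) -> finite_arcs R D.
Proof.
have [S0 _ D0 DSv] := DS.
move=> fS cD [w Dw wn].
pose W k := [set trunc k 0 v | v in [set v : seqR R | D v /\ 0 < v k]].
have fW k : finite_set (W k).
  have : finite_set (S `|` [set 0]) by rewrite finite_setU; split=> //; exact: finite_set1.
  move=> /(@finite_sequences _ (maxn n k).+1 w); apply: sub_finite_set => _ [v [Dv vk] <-].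
  split=> j jn.
    case: (ltngtP j k) => jk.
    - by right; rewrite trunc_lt.
    - by left; rewrite trunc_gt //; exact: (comb_up DS Dv vk).
    - by right; rewrite jk truncE.
  move: jn; rewrite gtn_max => /andP[nj kj].
  by rewrite trunc_gt // (Dn Dv Dw nj).
rewrite (_ : D = \bigcup_(k in `I_n.+1) \bigcup_(t in W k)
    (D `&` [set u : seqR R | forall j, j != k -> u j = t j])).
  apply: finite_arcs_bigcup => [|k kn]; first exact: finite_II.
  apply: (@finite_arcs_bigcup _ _ (seqR R)) => // _ [v [Dv vk] <-].
  by apply: finite_arcs1; exact: comb_branch.
apply/seteqP; split=> [v Dv|v [k _ [t _ []]]//].
have [[k kn vk]|nz] := pselect (exists2 k, (k <= n)%N & 0 < v k).
  have ex : exists k, 0 < v k by exists k.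
  case: (ex_minnP ex) => i vi mini.
  exists i; first by rewrite /= ltnS (leq_trans _ kn) // mini.
  exists (trunc i 0 v); first by exists v.
  split=> // j ji; case: (ltngtP j i) => ij.
  - rewrite trunc_lt //; apply/eqP; rewrite eq_le D0 // andbT leNgt.
    by apply/negP => /mini; rewrite leqNgt ij.
  - by rewrite trunc_gt.
  - by rewrite ij eqxx in ji.
exists n; first by rewrite /=.
exists (trunc n 0 w); first by exists w.
split=> // j jn; case: (ltngtP j n) => ij.
- rewrite trunc_lt //; apply/eqP; rewrite eq_le D0 // andbT leNgt.
  by apply/negP => vj; apply: nz; exists j => //; exact: ltnW.
- by rewrite trunc_gt //; exact: Dn.
- by rewrite ij eqxx in jn.
Qed.

Lemma comb_tree : finite_set S -> compact D -> connected D ->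
  (exists2 w, D w & 0 < w n) -> tree R D.
Proof.
move=> fS cD kD wD; split.
- by apply: continuum_seqR => //; have [w Dw _] := wD; exists w.
- exact: comb_uniquely_arcwise_connected.
- exact: comb_finite_arcs.
Qed.

End CombTree.

(** * Removing the function f from the inverse limit *)
Section Lipschitz.
Variable R : realType.

Lemma lipschitz1_continuous (h : R -> R) :
  (forall s t, `|h s - h t| <= `|s - t|) -> continuous h.
Proof.
move=> hl t V /nbhs_ballP[e e0 eV]; apply/nbhs_ballP; exists e => // s ts.
by apply: eV; apply: le_lt_trans (hl t s) ts.
Qed.

Lemma min_lipschitz (a s t : R) : `|Num.min s a - Num.min t a| <= `|s - t|.
Proof.
case: (leP s a) => sa; case: (leP t a) => ta; rewrite ?subrr ?normr0 //.
  by rewrite !ler0_norm; lra.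
by rewrite !ger0_norm; lra.
Qed.

Lemma min_continuous (a : R) : continuous (fun t : R => Num.min t a).
Proof. by apply: lipschitz1_continuous => s t; exact: min_lipschitz. Qed.

End Lipschitz.

Section Main.
Variables (R : realType) (C : rat -> set R) (f : R -> R).
Hypothesis C_cantor : forall r : rat, 0 <= r <= 1 ->
  cantor_set (C r) /\ C r `<=` `]0, 1].
Hypothesis C_decr : forall r s : rat, 0 <= r <= 1 -> 0 <= s <= 1 -> s < r ->
  C r `<=` C s.
Hypothesis f_unit : forall t, 0 <= t <= 1 -> 0 <= f t <= 1.
Hypothesis f_cont : {within `[0, 1], continuous f}.
Hypothesis f_zero : forall t, ([set 0] `|` C 0) t -> f t = 0.
Hypothesis f_min : forall m, is_min (C 0) m -> forall t, 0 <= t <= 1 -> f t < m.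
Hypothesis f_lt : forall t, 0 < t <= 1 -> f t < t.

Let r0 : 0 <= (0 : rat) <= 1. Proof. by rewrite lexx ler01. Qed.
Let r1 : 0 <= (1 : rat) <= 1. Proof. by rewrite lexx ler01. Qed.

Lemma C_unit r t : 0 <= r <= 1 -> C r t -> 0 < t <= 1.
Proof. by move=> rI Ct; have := (C_cantor rI).2 t Ct; rewrite /= in_itv. Qed.

Lemma C_closed r : 0 <= r <= 1 -> closed (C r).
Proof. by move=> /C_cantor[[_ _ [cC _] _] _]. Qed.

Lemma C_nonempty r : 0 <= r <= 1 -> C r !=set0.
Proof. by move=> /C_cantor[[]]. Qed.

Lemma C_anti r s : 0 <= r <= 1 -> 0 <= s <= 1 -> s <= r -> C r `<=` C s.
Proof. by move=> rI sI; rewrite le_eqVlt => /orP[/eqP->//|]; exact: C_decr. Qed.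

Lemma C0_codense a b : a < b -> exists2 c, a < c < b & ~ C 0 c.
Proof.
move=> ab; apply: contrapT => h.
have [[_ _ _ nd] _] := C_cantor r0.
suff : interior (closure (C 0)) ((a + b) / 2) by rewrite nd.
have : nbhs ((a + b) / 2) `]a, b[%classic.
  by apply: open_nbhs_nbhs; split; [exact: interval_open|rewrite /= in_itv /=; lra].
apply: filterS => t; rewrite /= in_itv /= => tI; apply: subset_closure.
by apply: contrapT => nC; apply: h; exists t.
Qed.

Lemma C0_min : exists m, is_min (C 0) m.
Proof.
have cC : compact (C 0).
  apply: (subclosed_compact (B := (`[0, 1]%classic : set R))); first exact: C_closed.
    exact: segment_compact.
  by move=> t /(C_unit r0); rewrite /= in_itv /=; lra.
have [|m /set_mem Cm mmin] := @compact_EVT_min _ R id (C 0) (C_nonempty r0) cC.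
  by apply: continuous_subspaceT => t; exact: cvg_id.
by exists m; split=> // t Ct; apply: mmin; rewrite inE.
Qed.

Lemma f_below t c : 0 <= t <= 1 -> C 0 c -> f t < c.
Proof.
move=> tI Cc; have [m mm] := C0_min; apply: lt_le_trans (f_min mm tI) _.
exact: mm.2.
Qed.

Lemma f_at0 : f 0 = 0. Proof. by apply: f_zero; left. Qed.

Lemma f_on_C0 t : C 0 t -> f t = 0. Proof. by move=> Ct; apply: f_zero; right. Qed.

Lemma f_le t : 0 <= t <= 1 -> f t <= t.
Proof.
move=> /andP[]; rewrite le_eqVlt => /orP[/eqP<-|t0 t1]; first by rewrite f_at0.
by apply/ltW/f_lt; rewrite t0.
Qed.

Definition limit_space : set (seqR R) :=
  inverse_limit (fun _ : nat => `[0, 1]%classic : set R)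
                (fun _ : nat => bonding C f).

(** This replaces the supremum by closed conditions, one for each rational. *)
Lemma bondingP s t : 0 <= s <= 1 -> 0 <= t <= 1 -> bonding C f t s <->
  0 <= s - f t /\ forall r : rat, 0 <= r <= 1 -> s - f t <= ratr r \/ C r t.
Proof.
move=> sI tI; rewrite /bonding; case: ifPn => [/set_mem Ct|nCt]; last first.
  split=> [->|[fs /(_ 0 r0)]].
    by rewrite subrr; split=> // r /andP[r0' _]; left; rewrite ler0q.
  rewrite rmorph0 => -[fs'|/mem_set]; last by rewrite (negbTE nCt).
  by apply/eqP; rewrite -subr_eq0 eq_le fs fs'.
rewrite f_on_C0 // subr0; set E := [set _ | _ in _].
have E0 : E 0 by exists 0; rewrite ?rmorph0.
have hE : has_sup E.
  split; first by exists 0.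
  by exists 1 => _ [r [/andP[_ rl1] _] <-]; rewrite -(rmorph1 (@ratr R)) ler_rat.
rewrite /= in_itv /=; split=> [/andP[s0 sE]|[s0 H]].
  split=> // r rI; have [sr|rs] := leP s (ratr r); [by left|right].
  have [_ [q [qI Cq] <-]] := @sup_gt _ E (ratr r) (ex_intro _ _ E0) (lt_le_trans rs sE).
  by rewrite ltr_rat => rq; apply: (C_anti qI rI (ltW rq)).
rewrite s0 /= leNgt; apply/negP => Es.
have [q] := rat_in_itvoo Es; rewrite in_itv /= => /andP[Eq qs].
have E0' : 0 <= sup E by apply: ub_le_sup => //; exact: hE.2.
have qI : 0 <= q <= 1.
  by rewrite -(ler0q R) -(ler_rat R) rmorph1; lra.
have [|Cq] := H q qI; first by rewrite leNgt qs.
have : ratr q <= sup E by apply: ub_le_sup; [exact: hE.2|exists q].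
by rewrite leNgt Eq.
Qed.

Lemma limit_spaceP x : limit_space x <->
  forall i, [/\ 0 <= x i <= 1, 0 <= x i - f (x i.+1) &
  forall r : rat, 0 <= r <= 1 -> x i - f (x i.+1) <= ratr r \/ C r (x i.+1)].
Proof.
split=> [[xI xF] i|H].
  have I j : 0 <= x j <= 1 by have := xI j; rewrite /= in_itv.
  by have [? ?] := (bondingP (I i) (I i.+1)).1 (xF i); split.
split=> i; first by have [] := H i; rewrite /= in_itv.
have [xi x0 xr] := H i; have [xi' _ _] := H i.+1.
by apply/bondingP.
Qed.

Definition flattening (x : seqR R) : seqR R := fun i => x i - f (x i.+1).

(** The inverse limit for the zero function in place of [f], written with the
closed conditions of [bondingP]. *)
Definition flat_limit : set (seqR R) := [set z | forall i, 0 <= z i <= 1 /\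
  forall r : rat, 0 <= r <= 1 -> z i <= ratr r \/ C r (z i.+1)].

Lemma flat_limit_up z i : flat_limit z -> 0 < z i -> C 0 (z i.+1).
Proof.
by move=> Zz zi; have [_ /(_ 0 r0)] := Zz i; rewrite rmorph0 => -[|//]; lra.
Qed.

Lemma C_pos t : C 0 t -> 0 < t.
Proof. by move=> /(C_unit r0)/andP[]. Qed.

Lemma flat_limit_comb : comb flat_limit (C 0).
Proof.
split.
- exact: C_pos.
- exact: C0_codense.
- by move=> z i Zz; have [/andP[]] := Zz i.
- exact: flat_limit_up.
Qed.

Lemma flat_limit0 : flat_limit (fun _ => 0).
Proof.
move=> i; split; first by rewrite lexx ler01.
by move=> r /andP[r0' _]; left; rewrite ler0q.
Qed.

Lemma flat_limit_trunc z i s : flat_limit z -> 0 <= s <= z i -> flat_limit (trunc i s z).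
Proof.
move=> Zz /andP[s0 sz] j; have [zj zr] := Zz j.
case: (ltngtP j i) => ij.
- rewrite trunc_lt //; split; first by rewrite lexx ler01.
  by move=> r /andP[r0' _]; left; rewrite ler0q.
- by rewrite !trunc_gt // ltnW.
- subst j; rewrite truncE trunc_gt //; split; first by lra.
  by move=> r /zr[zir|]; [left; lra|right].
Qed.

Lemma limit_space_up x i : limit_space x -> C 0 (x i) -> C 0 (x i.+1).
Proof.
move=> /limit_spaceP Xx Cx; have [xi x0 /(_ 0 r0)] := Xx i; rewrite rmorph0 => -[fx|//].
have [xi' _ _] := Xx i.+1; have := f_below xi' Cx.
have -> : f (x i.+1) = x i by lra.
by rewrite ltxx.
Qed.

Lemma flattening_id x i : limit_space x -> C 0 (x i) -> flattening x i = x i.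
Proof. by move=> Xx Cx; rewrite /flattening f_on_C0 ?subr0 //; exact: limit_space_up. Qed.

Lemma flattening_flat x : limit_space x -> flat_limit (flattening x).
Proof.
move=> Xx i; have /limit_spaceP/(_ i)[xi x0 xr] := Xx.
have /limit_spaceP/(_ i.+1)[xi' _ _] := Xx.
split; first by have := f_unit xi'; rewrite /flattening; lra.
move=> r rI; have [|Cx] := xr r rI; [by left|right].
by rewrite flattening_id //; apply: C_anti Cx => //; case/andP: rI.
Qed.

(** Such coordinates increase to a limit fixed by [f], and [f] has no fixed point
except [0]. *)
Lemma limit_space_zero x : limit_space x -> (forall i, x i = f (x i.+1)) ->
  forall i, x i = 0.
Proof.
move=> Xx xf; have xI i : 0 <= x i <= 1 by have /limit_spaceP/(_ i)[] := Xx.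
have xS i : x i <= x i.+1 by rewrite {1}xf f_le.
pose E := range x; have hE : has_sup E.
  by split; [exists (x 0%N), 0%N|exists 1 => _ [i _ <-]; case/andP: (xI i)].
have xE i : x i <= sup E by apply: ub_le_sup; [exact: hE.2|exists i].
have E1 : sup E <= 1.
  by apply: ge_sup; [exact: hE.1|move=> _ [i _ <-]; case/andP: (xI i)].
have [E0|E0] := ltP 0 (sup E); last first.
  by move=> i; apply/eqP; rewrite eq_le; have := xI i; have := xE i; lra.
have fE : f (sup E) < sup E by apply: f_lt; rewrite E0.
pose mid := (f (sup E) + sup E) / 2.
have EI : (`[0, 1]%classic : set R) (sup E) by rewrite /= in_itv /= E1 ltW.
have nV : nbhs (f (sup E)) [set t : R | t < mid].
  by apply: open_nbhs_nbhs; split; [exact: open_lt|rewrite /= /mid; lra].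
have /nbhs_ballP[e /= e0 eV] := within_comp_nbhs f_cont EI nV.
have [|_ [i _ <-]] := @sup_gt _ E (Num.max mid (sup E - e)) hE.1.
  by rewrite gt_max /mid; lra.
rewrite gt_max => /andP[mx ex].
have /= : f (x i.+1) < mid.
  apply: eV; last by rewrite /= in_itv /= xI.
  by rewrite /ball /= ger0_norm; have := xS i; have := xE i.+1; lra.
by rewrite -xf; lra.
Qed.

Lemma limit_space_C_or_zero x : limit_space x ->
  (exists i, C 0 (x i)) \/ forall i, x i = 0.
Proof.
move=> Xx; have [|nC] := pselect (exists i, C 0 (x i)); first by left.
right; apply: limit_space_zero => // i; have /limit_spaceP/(_ i)[xi x0 /(_ 0 r0)] := Xx.
rewrite rmorph0 => -[|Cx]; first by lra.
by case: nC; exists i.+1.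
Qed.

(** Once [x] meets [C 0] at stage [i], all its later coordinates can be read off
[flattening x], and [f] recovers the earlier ones. *)
Lemma flattening_inj_at x y i : limit_space x -> limit_space y ->
  flattening x = flattening y -> C 0 (x i) -> x = y.
Proof.
move=> Xx Xy xy Cxi.
have Cx j : (i <= j)%N -> C 0 (x j).
  elim: j => [|j IH]; rewrite leq_eqVlt => /orP[/eqP<-//|]; rewrite // ltnS.
  by move=> /IH/(limit_space_up Xx).
have later j : (i <= j)%N -> x j = y j.
  move=> ij; rewrite -flattening_id ?xy //; last exact: Cx.
  have /limit_spaceP/(_ j)[yj y0 /(_ 0 r0)] := Xy; rewrite rmorph0.
  case=> [yf|Cy]; last by rewrite /flattening f_on_C0 ?subr0.
  by have := C_pos (Cx j ij); rewrite -flattening_id ?xy ?/flattening //; [lra|exact: Cx].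
have earlier k j : x j = y j -> (j = k + (j - k))%N -> x (j - k)%N = y (j - k)%N.
  elim: k => [|k IH] xyj jk; first by rewrite subn0.
  have e : (j - k = (j - k.+1).+1)%N by lia.
  have := congr1 (fun z : seqR R => z (j - k.+1)%N) xy.
  by rewrite /flattening -e IH //; [lra|lia].
apply: functional_extensionality_dep => j; have [/later//|ji] := leqP i j.
by have := earlier (i - j)%N i (later i (leqnn i)); rewrite subKn ?(ltnW ji) //; apply; lia.
Qed.

Lemma flattening_inj : set_inj limit_space flattening.
Proof.
move=> x y /set_mem Xx /set_mem Xy xy.
have [[i Cx]|x0] := limit_space_C_or_zero Xx; first exact: (flattening_inj_at Xx Xy xy Cx).
have [[i Cy]|y0] := limit_space_C_or_zero Xy.
  by apply/esym; apply: (flattening_inj_at Xy Xx (esym xy) Cy).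
by apply: functional_extensionality_dep => j; rewrite x0 y0.
Qed.

(** Solves [x i = z i + f (x i.+1)] downwards from [x (k + i) = z (k + i)]. *)
Fixpoint rebuild (z : seqR R) k i : R :=
  if k is k'.+1 then z i + f (rebuild z k' i.+1) else z i.

Lemma rebuild_spec z N : flat_limit z -> C 0 (z N) -> forall k i, (k + i = N)%N ->
  0 <= rebuild z k i <= 1 /\ (C 0 (z i) -> rebuild z k i = z i).
Proof.
move=> Zz CN; elim=> [|k IH] i kiN /=; first by have [] := Zz i.
have [|rI rC] := IH i.+1; first by lia.
have [zI _] := Zz i.
have [zi|zi] := ltP 0 (z i).
  have Cz := flat_limit_up Zz zi; rewrite (rC Cz) f_on_C0 // addr0; by split.
have -> : z i = 0 by lra.
rewrite add0r; split; first exact: f_unit.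
by move=> /C_pos; rewrite ltxx.
Qed.

Lemma flattening_surj z : flat_limit z -> exists2 x, limit_space x & flattening x = z.
Proof.
move=> Zz; have [[N CN]|nC] := pselect (exists N, C 0 (z N)); last first.
  have -> : z = fun _ => 0.
    apply: functional_extensionality_dep => i; have [zI /(_ 0 r0)] := Zz i.
    by rewrite rmorph0 => -[|Cz]; [lra|case: nC; exists i.+1].
  exists (fun _ => 0); last first.
    by apply: functional_extensionality_dep => i; rewrite /flattening f_at0 subr0.
  apply/limit_spaceP => i; rewrite f_at0 subr0 lexx ler01; split=> // r /andP[r0' _].
  by left; rewrite ler0q.
have CN' j : (N <= j)%N -> C 0 (z j).
  elim: j => [|j IH]; rewrite leq_eqVlt => /orP[/eqP<-//|]; rewrite // ltnS => /IH Cz.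
  by apply: flat_limit_up => //; exact: C_pos.
pose x : seqR R := fun i => rebuild z (N - i) i.
have xS i : x i = z i + f (x i.+1).
  rewrite /x; case: (ltnP i N) => iN.
    by have -> : (N - i = (N - i.+1).+1)%N by lia.
  have [-> ->] : (N - i = 0)%N /\ (N - i.+1 = 0)%N by lia.
  by rewrite /= f_on_C0 ?addr0 //; apply: CN'; lia.
have xP i : 0 <= x i <= 1 /\ (C 0 (z i) -> x i = z i).
  rewrite /x; case: (ltnP i N) => iN; first by apply: (rebuild_spec Zz CN); lia.
  have -> : (N - i = 0)%N by lia.
  by split=> //=; have [] := Zz i.
have xz : flattening x = z.
  by apply: functional_extensionality_dep => i; rewrite /flattening xS addrK.
exists x => //; apply/limit_spaceP => i.
have E : x i - f (x i.+1) = z i by rewrite xS addrK.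
rewrite E; have [zI zr] := Zz i; split; [exact: (xP i).1|by case/andP: zI|].
move=> r rI; have [|Cz] := zr r rI; [by left|right].
have Cz0 : C 0 (z i.+1) by apply: C_anti Cz => //; case/andP: rI.
by rewrite (xP _).2.
Qed.

Lemma flattening_image : flattening @` limit_space = flat_limit.
Proof.
by apply/seteqP; split=> [_ [x Xx <-]|z /flattening_surj[x Xx <-]]; [exact: flattening_flat|exists x].
Qed.

(** [f] is continuous on the unit interval only; composing it with the retraction
onto that interval makes the conditions defining the limit closed in the whole
product. *)
Definition f_extended (t : R) := f (Num.max 0 (Num.min t 1)).

Lemma f_extendedE t : 0 <= t <= 1 -> f_extended t = f t.
Proof. by move=> /andP[t0 t1]; rewrite /f_extended min_l // max_r. Qed.

Lemma f_extended_continuous : continuous f_extended.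
Proof.
have clamp (t : R) : 0 <= Num.max 0 (Num.min t 1) <= 1.
  by rewrite le_max lexx /= ge_max ler01 ge_min lexx orbT.
apply/continuous_subspace_setT.
apply: (within_continuous_compose (h := fun t : R => Num.max 0 (Num.min t 1)) _ f_cont).
  apply: continuous_subspaceT; apply: lipschitz1_continuous => s t.
  apply: le_trans (min_lipschitz 1 s t).
  set a := Num.min s 1; set b := Num.min t 1.
  case: (leP 0 a) => a0; case: (leP 0 b) => b0; rewrite ?subrr ?normr0 //.
    by rewrite !ger0_norm; lra.
  by rewrite !ler0_norm; lra.
by move=> t _; rewrite /= in_itv /= clamp.
Qed.

Lemma f_extended_diff_continuous i :
  continuous (fun x : seqR R => x i - f_extended (x i.+1)).
Proof.
have c1 : continuous (fun x : seqR R => x i : R).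
  exact: (@prod_coord_continuous (fun _ => R)).
have c2 : continuous (fun x : seqR R => f_extended (x i.+1)).
  move=> x; apply: (@continuous_comp _ _ _ (fun x : seqR R => x i.+1) f_extended).
    exact: (@prod_coord_continuous (fun _ => R)).
  exact: f_extended_continuous.
by move=> x; exact: (cvgB (c1 x) (c2 x)).
Qed.

Lemma closed_preim (g : seqR R -> R) (A : set R) :
  continuous g -> closed A -> closed [set x | A (g x)].
Proof. by move=> gc cA; apply: (closed_comp (f := g)) => // x _; exact: gc. Qed.

Lemma limit_space_compact : compact limit_space.
Proof.
have cube : compact [set x : seqR R | forall i, (`[0, 1]%classic : set R) (x i)].
  by apply: (@tychonoff nat (fun _ => R) (fun _ => `[0, 1]%classic)) => i; exact: segment_compact.
pose d i (x : seqR R) := x i - f_extended (x i.+1).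
have dc i : continuous (d i).
  exact: f_extended_diff_continuous.
have -> : limit_space = [set x : seqR R | forall i, (`[0, 1]%classic : set R) (x i)] `&`
    (\bigcap_i [set x | 0 <= d i x] `&`
     \bigcap_i \bigcap_(r in [set r : rat | 0 <= r <= 1])
       ([set x | d i x <= ratr r] `|` [set x | C r (x i.+1)])).
  apply/seteqP; split=> [x /limit_spaceP Xx|x [xI [x0 xr]]].
    have xI i : 0 <= x i <= 1 by have [] := Xx i.
    split; first by move=> i; rewrite /= in_itv /= xI.
    split=> i _; first by rewrite /= /d f_extendedE //; have [] := Xx i.
    by move=> r rI; have [_ _ /(_ r rI)] := Xx i; rewrite /= /d f_extendedE //.
  have I i : 0 <= x i <= 1 by have := xI i; rewrite /= in_itv.
  apply/limit_spaceP => i; split=> //.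
    by have := x0 i Logic.I; rewrite /= /d f_extendedE.
  by move=> r rI; have := xr i Logic.I r rI; rewrite /= /d f_extendedE.
apply: compact_closedI => //; apply: closedI; apply: closed_bigI => i _.
  by apply: (closed_preim (A := [set t | 0 <= t])) => //; exact: closed_ge.
apply: closed_bigI => r rI; apply: closedU.
  by apply: (closed_preim (A := [set t | t <= ratr r])) => //; exact: closed_le.
by apply: closed_coord; exact: C_closed.
Qed.

Lemma flattening_continuous : {within limit_space, continuous flattening}.
Proof.
apply: within_continuous_prod => i.
apply: (@within_continuous_eq _ _ _ (fun x : seqR R => x i - f_extended (x i.+1))).
  exact/continuous_subspaceT/f_extended_diff_continuous.
by move=> x /limit_spaceP/(_ i.+1)[xI _ _]; rewrite /flattening f_extendedE.
Qed.

Lemma flat_limit_compact : compact flat_limit.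
Proof.
rewrite -flattening_image.
by apply: continuous_compact; [exact: flattening_continuous|exact: limit_space_compact].
Qed.

Lemma flat_limit_connected : connected flat_limit.
Proof.
have [_ _ Zge _] := flat_limit_comb.
apply: star_connected => //.
- by apply: compact_closed; [exact: seqR_hausdorff|exact: flat_limit_compact].
- exact: flat_limit0.
- by move=> z i s; exact: flat_limit_trunc.
Qed.

Lemma limit_space_nonempty : limit_space !=set0.
Proof. by have [x Xx _] := flattening_surj flat_limit0; exists x. Qed.

Lemma limit_space_continuum : continuum R limit_space.
Proof.
apply: continuum_seqR; [exact: limit_space_nonempty|exact: limit_space_compact|].
have [k [_ _ [kth _] _ kc]] := injective_homeomorphism limit_space_nonempty limit_space_compact
  (@seqR_hausdorff R) flattening_continuous flattening_inj.
rewrite (_ : limit_space = k @` (flattening @` limit_space)).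
  by apply: connected_continuous_connected => //; rewrite flattening_image; exact: flat_limit_connected.
apply/seteqP; split=> [x Xx|_ [_ [x Xx <-] <-]]; last by rewrite kth.
by exists (flattening x); [exists x|exact: kth].
Qed.

Lemma limit_space_hereditarily_decomposable : hereditarily_decomposable R limit_space.
Proof.
apply: (hereditarily_decomposable_injective flattening_continuous flattening_inj).
by rewrite flattening_image; exact: (comb_hereditarily_decomposable flat_limit_comb).
Qed.

(** * Collapsing onto trees *)

(** Rational end points make the gaps of [C 0] countable; the intervals need not
be maximal. *)
Definition gap (p : rat * rat) :=
  [/\ 0 <= p.1, p.1 < p.2 & forall t, C 0 t -> ~ ratr p.1 < t < ratr p.2].

(** Indices that do not code a gap give the degenerate interval at [0], which
contributes nothing to [staircase]. *)
Definition nth_gap (j : nat) : R * R :=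
  if unpickle j is Some p then
    if `[< gap p >] then (ratr p.1, ratr p.2) else (0, 0)
  else (0, 0).

Lemma nth_gapP j : 0 <= (nth_gap j).1 <= (nth_gap j).2 /\
  forall t, C 0 t -> ~ (nth_gap j).1 < t < (nth_gap j).2.
Proof.
rewrite /nth_gap; case: (unpickle j) => [p|]; last first.
  by split=> [|t _] /=; [rewrite lexx|move=> /andP[t0 /(lt_trans t0)]; rewrite ltxx].
case: asboolP => [[p0 p12 pC]|_]; last first.
  by split=> [|t _] /=; [rewrite lexx|move=> /andP[t0 /(lt_trans t0)]; rewrite ltxx].
by split=> //=; rewrite ler0q p0 ler_rat ltW.
Qed.

Lemma gap_between s t : 0 <= s -> s < t -> exists j,
  s < (nth_gap j).1 /\ (nth_gap j).1 < (nth_gap j).2 < t.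
Proof.
move=> s0 st; have [c /andP[sc ct] nC] := C0_codense st.
have : nbhs c (~` C 0).
  by apply: open_nbhs_nbhs; split=> //; exact: closed_openC (C_closed r0).
move=> /nbhs_ballP[e /= e0 eC].
have lc : Num.max s (c - e) < c by rewrite gt_max sc; lra.
have [a] := rat_in_itvoo lc; rewrite in_itv /= gt_max => /andP[/andP[sa ea] ac].
have cr : c < Num.min t (c + e) by rewrite lt_min ct; lra.
have [b] := rat_in_itvoo cr; rewrite in_itv /= lt_min => /andP[cb /andP[bt be]].
have gab : gap (a, b).
  split=> /=.
  - by rewrite -(ler0q R); lra.
  - by rewrite -(ltr_rat R); lra.
  - move=> u Cu uab; apply: (eC u) => //.
    by rewrite /ball /= ltr_distlC; lra.
exists (pickle (a, b)); rewrite /nth_gap pickleK asboolT //=; split=> //.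
by rewrite bt andbT; lra.
Qed.

Definition C0_least := xget 0 (is_min (C 0)).

Lemma C0_leastP : is_min (C 0) C0_least.
Proof. exact: xgetPex C0_min. Qed.

Lemma C0_least_gt0 : 0 < C0_least.
Proof. by have [Cm _] := C0_leastP; exact: C_pos. Qed.

(** For [t >= 0], the length of what lies to the left of [t] in the first [n]
gaps, counted with multiplicity, and in the gap before the least element of
[C 0].  Including the latter makes the
function positive at every positive argument. *)
Fixpoint staircase n t : R :=
  if n is k.+1 then
    staircase k t + (Num.min t (nth_gap k).2 - Num.min t (nth_gap k).1)
  else Num.min t C0_least.

Lemma staircase_continuous n : continuous (staircase n).
Proof.
elim: n => [|n IH]; first exact: min_continuous.
move=> t; apply: cvgD; first exact: IH.
by apply: cvgB; exact: min_continuous.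
Qed.

Lemma clamp_le (a b s t : R) : a <= b -> s <= t ->
  Num.min s b - Num.min s a <= Num.min t b - Num.min t a.
Proof.
move=> ab st; case: (leP s a) => sa; case: (leP s b) => sb;
  case: (leP t a) => ta; case: (leP t b) => tb; lra.
Qed.

Lemma staircase_le n s t : s <= t -> staircase n s <= staircase n t.
Proof.
move=> st; elim: n => [|n IH] /=; first by rewrite le_min !ge_min st lexx orbT.
by rewrite lerD // clamp_le //; have [/andP[]] := nth_gapP n.
Qed.

Lemma staircase0 n : staircase n 0 = 0.
Proof.
elim: n => [|n IH] /=; first by rewrite min_l // ltW // C0_least_gt0.
have [/andP[a0 ab] _] := nth_gapP n.
by rewrite IH !min_l ?(le_trans a0 ab) // subrr addr0.
Qed.

Lemma staircase_gt0 n t : 0 < t -> 0 < staircase n t.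
Proof.
move=> t0; elim: n => [|n IH] /=; first by rewrite lt_min t0 C0_least_gt0.
have [/andP[_ ab] _] := nth_gapP n.
rewrite ltr_wpDr // subr_ge0 le_min !ge_min lexx /= ab orbT //.
Qed.

Lemma staircase_finite n : finite_set (staircase n @` C 0).
Proof.
elim: n => [|n IH].
  apply: sub_finite_set (finite_set1 C0_least) => _ [t Ct <-] /=.
  by rewrite min_r //; exact: C0_leastP.2.
have [/andP[_ ab] gC] := nth_gapP n; set a := (nth_gap n).1 in ab gC *.
set b := (nth_gap n).2 in ab gC *.
have fU : finite_set ([set 0; b - a] : set R) by exact: finite_set2.
apply: sub_finite_set (finite_image (fun p : R * R => p.1 + p.2) (finite_setX IH fU)).
move=> _ [t Ct <-]; exists (staircase n t, Num.min t b - Num.min t a) => //.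
split; first by exists t.
have [ta|at_] := leP t a.
  by left; rewrite /= !min_l ?subrr // (le_trans ta).
have [tb|bt] := ltP t b; first by case: (gC t Ct); rewrite at_.
by right.
Qed.

Lemma staircase_coarsen n s t : staircase n.+1 s = staircase n.+1 t ->
  staircase n s = staircase n t.
Proof.
wlog st : s t / s <= t => [H|] E.
  by have [/H|/ltW/H h] := leP s t; [exact|exact/esym/h/esym].
have [/andP[_ ab] _] := nth_gapP n.
have := staircase_le n st; have := clamp_le ab st; move: E => /=; lra.
Qed.

Lemma staircase_coarsen_le n k s t : (k <= n)%N ->
  staircase n s = staircase n t -> staircase k s = staircase k t.
Proof.
elim: n => [|n IH]; first by rewrite leqn0 => /eqP->.
by rewrite leq_eqVlt => /orP[/eqP->//|kn /staircase_coarsen]; exact: IH.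
Qed.

(** Between two points there is a gap of [C 0], since [C 0] has empty interior. *)
Lemma staircase_separates s t : 0 <= s -> 0 <= t ->
  (forall n, staircase n s = staircase n t) -> s = t.
Proof.
wlog st : s t / s < t => [H s0 t0 E|s0 _ E].
  have [st|ts|//] := ltgtP s t; first exact: H.
  by apply/esym/H => // n; rewrite E.
have [j [sa ab]] := gap_between s0 st; have := E j.+1; rewrite /= (E j).
have := ab; case/andP => ab1 bt.
rewrite (min_l (ltW sa)) (min_l (ltW (lt_trans sa ab1))).
rewrite (min_r (ltW bt)) (min_r (ltW (lt_trans ab1 bt))); lra.
Qed.

Lemma staircase_ivt n t s : 0 <= t -> 0 <= s <= staircase n t ->
  exists2 u, 0 <= u <= t & staircase n u = s.
Proof.
move=> t0 /andP[s0 st].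
have sc : {within `[0, t], continuous (staircase n)}.
  by apply: continuous_subspaceT; exact: staircase_continuous.
have sI : Num.min (staircase n 0) (staircase n t) <= s <= Num.max (staircase n 0) (staircase n t).
  by rewrite staircase0 ge_min le_max s0 st orbT.
have [u uI us] := IVT t0 sc sI.
by exists u => //; move: uI; rewrite in_itv.
Qed.

(** The value [1] at the forgotten coordinates serves as an additional element of
the set over which the image is a comb: positivity of coordinate [n] demands
nothing further. *)
Definition collapse n (z : seqR R) : seqR R :=
  fun j => if (j <= n)%N then staircase n (z j) else 1.

Lemma collapse_continuous n A : {within A, continuous (collapse n)}.
Proof.
have c1 j : continuous (fun z : seqR R => staircase n (z j)).
  move=> z; apply: (@continuous_comp _ _ _ (fun x : seqR R => x j) (staircase n)).
    exact: (@prod_coord_continuous (fun _ => R)).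
  exact: staircase_continuous.
have c2 : continuous (fun _ : seqR R => 1 : R) by exact: cst_continuous.
apply: within_continuous_prod => j; apply: continuous_subspaceT; rewrite /collapse.
by case: (j <= n)%N; [exact: c1|exact: c2].
Qed.

Lemma flat_limit_ge0 z j : flat_limit z -> 0 <= z j.
Proof. by move=> /(_ j)[/andP[]]. Qed.

Lemma collapse_comb n : comb (collapse n @` flat_limit) (staircase n @` C 0 `|` [set 1]).
Proof.
split.
- by move=> _ [[t Ct <-]|->//]; apply: staircase_gt0; exact: C_pos.
- move=> a b; apply: finite_not_interval; rewrite finite_setU.
  by split; [exact: staircase_finite|exact: finite_set1].
- move=> _ i [z Zz <-]; rewrite /collapse; case: ifP => // _.
  by rewrite -(staircase0 n); apply: staircase_le; exact: flat_limit_ge0.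
move=> _ i [z Zz <-]; rewrite /collapse; case: (ltnP i n) => [iltn|ni]; last by right.
rewrite (ltnW iltn) => si; left; exists (z i.+1) => //; apply: flat_limit_up => //.
by rewrite lt_neqAle flat_limit_ge0 // andbT; apply/eqP => E; move: si; rewrite -E staircase0 ltxx.
Qed.

Lemma collapse_trunc n v i s : (collapse n @` flat_limit) v -> (i <= n)%N ->
  0 <= s <= v i ->
  (collapse n @` flat_limit) (trunc i s v).
Proof.
move=> [z Zz <-] iln; rewrite {1}/collapse iln => sI.
have [u uI <-] := staircase_ivt (flat_limit_ge0 i Zz) sI.
exists (trunc i u z); first exact: flat_limit_trunc.
apply: functional_extensionality_dep => j; rewrite /collapse /trunc.
case: (ltngtP j i) => //= ji; last by rewrite ji iln.
by rewrite (leq_trans (ltnW ji) iln) staircase0.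
Qed.

Lemma collapse_tree n : tree R (collapse n @` flat_limit).
Proof.
apply: (@comb_tree R _ (staircase n @` C 0 `|` [set 1]) n).
- exact: collapse_comb.
- exact: collapse_trunc.
- by move=> _ _ j [z Zz <-] [w Zw <-] nj; rewrite /collapse leqNgt nj.
- by rewrite finite_setU; split; [exact: staircase_finite|exact: finite_set1].
- apply: continuous_compact flat_limit_compact.
  exact: collapse_continuous.
- apply: connected_continuous_connected flat_limit_connected _.
  exact: collapse_continuous.
(* the constant sequence at a point of [C 1] belongs to the flat limit *)
have [c Cc] := C_nonempty r1; have /andP[c0 c1] := C_unit r1 Cc.
exists (collapse n (fun _ => c)); last by rewrite /collapse leqnn staircase_gt0.
exists (fun _ => c) => // i; split; first by rewrite ltW.
move=> r rI; right; apply: (C_anti r1 rI) => //; by case/andP: rI.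
Qed.

Lemma limit_space_tree_like : tree_like R limit_space.
Proof.
apply: (@tree_like_collapse R _ _ limit_space (fun n => collapse n \o flattening)).
- exact: limit_space_nonempty.
- exact: limit_space_compact.
- exact: seqR_hausdorff.
- move=> n; apply: (within_continuous_compose (B := setT)) => //.
    exact: flattening_continuous.
  exact: collapse_continuous.
- move=> n x y _ _ /= E; apply: functional_extensionality_dep => j.
  have := congr1 (fun v : seqR R => v j) E; rewrite /collapse.
  case: (leqP j n) => // jn; rewrite leqW //; exact: staircase_coarsen.
- move=> x y Xx Xy E; apply: flattening_inj; rewrite ?inE //.
  apply: functional_extensionality_dep => j.
  apply: staircase_separates; [exact/flat_limit_ge0/flattening_flat|exact/flat_limit_ge0/flattening_flat|] => n.
  apply: (@staircase_coarsen_le (n + j)%N); first by rewrite leq_addr.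
  have := congr1 (fun v : seqR R => v j) (E (n + j)%N).
  by rewrite /= /collapse leq_addl.
by move=> n; rewrite -image_comp flattening_image; exact: collapse_tree.
Qed.

End Main.

Theorem theorem3p12 (R : realType) (C : rat -> set R) (f : R -> R)
  (C_cantor : forall r : rat, 0 <= r <= 1 ->
    cantor_set (C r) /\ C r `<=` `]0, 1])
  (C_decr : forall r s : rat, 0 <= r <= 1 -> 0 <= s <= 1 -> s < r ->
    C r `<` C s /\ (forall x, C r x -> ~ endpoint (C s) x))
  (f_unit : forall t, 0 <= t <= 1 -> 0 <= f t <= 1)
  (f_cont : {within `[0, 1], continuous f})
  (f_zero : forall t, ([set 0] `|` C 0) t -> f t = 0)
  (f_min : forall m, is_min (C 0) m -> forall t, 0 <= t <= 1 -> f t < m)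
  (f_lt : forall t, 0 < t <= 1 -> f t < t) :
  let X : set (prod_topology (fun _ : nat => R)) :=
    inverse_limit (fun _ : nat => `[0, 1]%classic : set R)
                  (fun _ : nat => bonding C f) in
  [/\ continuum R X, hereditarily_decomposable R X & tree_like R X].
Proof.
have Csub r s : 0 <= r <= 1 -> 0 <= s <= 1 -> s < r -> C r `<=` C s.
  by move=> rI sI sr; have [[]] := C_decr r s rI sI sr.
split.
- exact: (limit_space_continuum C_cantor Csub f_unit f_cont f_zero f_min f_lt).
- exact: (limit_space_hereditarily_decomposable C_cantor Csub f_unit f_cont f_zero f_min f_lt).
- exact: (limit_space_tree_like C_cantor Csub f_unit f_cont f_zero f_min f_lt).
Qed.
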